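(* Let $\bar a_1<\bar a_2<\cdots<\bar a_n$ be positive reals, let $\epsilon>0$ and $a_i:=\epsilon\bar a_i$. Write $\bar A_i:=\bar a_1+\cdots+\bar a_i$, $\bar A_{i:j}:=\sum_{k=i}^j\bar a_k$, and for a permutation $\pi$ of $\{1,\dots,n\}$, $\bar A_{\pi(i)}:=\bar a_{\pi(1)}+\cdots+\bar a_{\pi(i)}$; also $A_n:=\epsilon\bar A_n$. Let the disruption intensity be $\lambda(t)=\bar\lambda f(t)$ with fixed $\bar\lambda>0$ and $f$ a positive differentiable function on $[0,\infty)$ with $f_-:=\inf_{t\ge0}f(t)>0$ and $f_+:=\sup_{t\ge0}f(t)<\infty$. (i) Suppose $f$ is strictly decreasing on $[0,A_n]$, and for every permutation $\pi\ne\mathrm{id}$, $$|f'(0)|>\frac{2\bar\lambda\left((f_+)^2\bar A_n\sum_{i=1}^n\bar a_i^2+(f_+)^2\frac34(\bar A_n)^3\right)}{\sum_{i=1}^n\bar a_i(\bar A_i)^2-\sum_{i=1}^n\bar a_{\pi(i)}(\bar A_{\pi(i)})^2}.$$ Then for all sufficiently small $\epsilon>0$, SPT is optimal: $M_{1:n}(0)<M_{\pi(1):\pi(n)}(0)$ for every $\pi\ne\mathrm{id}$. (ii) Suppose $f$ is strictly increasing on $[0,A_n]$, and for every permutation $\pi$ with $(\pi(1),\dots,\pi(n))\ne(n,n-1,\dots,1)$, $$f'(0)>\frac{2\bar\lambda\left((f_+)^2\bar A_n\sum_{i=1}^n\bar a_i^2+(f_+)^2\frac34(\bar A_n)^3\right)}{\sum_{i=1}^n\bar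 a_{\pi(i)}(\bar A_{\pi(i)})^2-\sum_{i=1}^n\bar a_{n+1-i}(\bar A_{n+1-i:n})^2}.$$ Then for all sufficiently small $\epsilon>0$, LPT is optimal: $M_{n:1}(0)<M_{\pi(1):\pi(n)}(0)$ for every such $\pi$.
   Context: Model: a single machine processes a finite batch of tasks one at a time in a fixed order. A task of length $c>0$ requires $c$ units of uninterrupted processing. Disruptions occur at the points of a non-homogeneous Poisson process on $[0,\infty)$ with intensity function $\lambda(t)$. If a disruption occurs while a task is being processed, all work on it is lost and that task is restarted from scratch at the disruption time (no repair time); a task is completed once it has been processed for $c$ consecutive time units with no disruption, and the machine then immediately starts the next task. For a permutation $\pi$ of $\{1,\dots,n\}$, $M_{\pi(1):\pi(n)}(t)$ denotes the expected time, measured from $t$, to complete all tasks in the order $a_{\pi(1)},\dots,a_{\pi(n)}$ when processing of $a_{\pi(1)}$ starts at time $t$; $M_{1:n}$ corresponds to the identity (SPT order) and $M_{n:1}$ to the order $a_n,\dots,a_1$ (LPT order). *)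

(* Defs.v *)
From HB Require Import structures.
From mathcomp Require Import all_boot all_order all_algebra all_fingroup.
From mathcomp Require Import all_classical all_reals all_analysis.
Set Implicit Arguments. Unset Strict Implicit. Unset Printing Implicit Defensive.
Import Order.TTheory GRing.Theory Num.Theory.
Import numFieldNormedType.Exports.
Local Open Scope classical_set_scope.
Local Open Scope ring_scope.

Section Model.
Context {R : realType}.

(* Poisson probability mass function with mean m >= 0 (0^0 = 1, so m = 0 gives
   the Dirac mass at 0). *)
Definition pois_pmf (m : R) (k : nat) : R := m ^+ k / k`!%:R * expR (- m).

Definition mean_meas (lam : R -> R) (s t : R) : R :=
  (\int[@lebesgue_measure R]_(x in `]s, t]) lam x)%R.

(* N : T -> R -> nat is the counting process of disruptions, N w t = number of
   disruptions in (0,t]. It is a non-homogeneous Poisson process with intensity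
   lam: N(0)=0, sample paths are nondecreasing and right-continuous counting
   functions, and the increments over consecutive intervals are independent and
   Poisson distributed with means int lam (joint pmf = product of Poisson pmfs). *)
Definition is_nhpp d (T : measurableType d) (P : probability T R)
    (lam : R -> R) (N : T -> R -> nat) : Prop :=
  [/\ forall w, N w 0 = 0%N,
      forall w s t, 0 <= s -> s <= t -> (N w s <= N w t)%N,
      forall w t, 0 <= t -> exists2 e : R, 0 < e &
         forall u, t <= u -> u < t + e -> N w u = N w t,
      forall t k, measurable [set w | N w t = k]
    & forall (n : nat) (ts : nat -> R) (ks : nat -> nat),
        0 <= ts 0%N -> (forall i, ts i <= ts i.+1) ->
        P (\bigcap_(i in `I_n) [set w | (N w (ts i.+1) - N w (ts i))%N = ks i])
        = (\prod_(i < n) pois_pmf (mean_meas lam (ts i) (ts i.+1)) (ks i))%:E ].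

Definition jump (N : R -> nat) (r : R) : Prop :=
  forall s, 0 <= s -> s < r -> (N s < N r)%N.

(* completion time of a task of length c whose processing starts at t, for the
   disruption path N: restarts happen at t and at every disruption after t; the
   task completes at r + c for the first restart time r followed by c time units
   free of disruptions ((r, r+c] contains no disruption).  +oo if never. *)
Definition task_finish (N : R -> nat) (t c : R) : \bar R :=
  ereal_inf [set (r + c)%:E | r in
     [set r | (r = t \/ (t < r /\ jump N r)) /\ N (r + c) = N r]].

Fixpoint completion (N : R -> nat) (t : R) (cs : seq R) : \bar R :=
  match cs with
  | [::] => t%:E
  | c :: cs' =>
      match task_finish N t c with
      | EFin r => completion N r cs'
      | EPInf => +oo%E
      | ENInf => -oo%E
      end
  end.

Definition exp_makespan d (T : measurableType d) (P : probability T R)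
    (N : T -> R -> nat) (t : R) (cs : seq R) : \bar R :=
  (\int[P]_w (completion (N w) t cs - t%:E))%E.

Definition sched n (abar : 'I_n -> R) (eps : R) (pi : 'S_n) : seq R :=
  [seq eps * abar (pi i) | i <- enum 'I_n].

Definition revperm n : 'S_n := perm (@rev_ord_inj n).

Definition Apref n (abar : 'I_n -> R) (pi : 'S_n) (i : 'I_n) : R :=
  \sum_(k < n | (k <= i)%N) abar (pi k).

Definition Ssum n (abar : 'I_n -> R) (pi : 'S_n) : R :=
  \sum_(i < n) abar (pi i) * (Apref abar pi i) ^+ 2.

End Model.

(* Main.v *)
Require Import Defs.
From HB Require Import structures.
From mathcomp Require Import all_boot all_order all_algebra all_fingroup.
From mathcomp Require Import all_classical all_reals all_analysis.
From mathcomp Require Import measurable_realfun zify ring lra.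
Set Implicit Arguments. Unset Strict Implicit. Unset Printing Implicit Defensive.
Import Order.TTheory GRing.Theory Num.Theory.
Import numFieldNormedType.Exports.
Local Open Scope classical_set_scope.
Local Open Scope ring_scope.

(** Order of magnitude: a disruption during the batch has probability O(eps) and
    costs O(eps), so the order of the tasks first matters at order eps^3.  With
    lam t = a + d t + o(t), the expected completion time of the tasks [cs] started at
    time [s] is [psi a d s cs] up to o(eps^3), where the part of [psi] that depends on
    the order is d/2 times the sum of a_i (A_i)^2.  This sum is largest for SPT and
    smallest for LPT, because each pair x < y contributes x y^2 if x comes first and
    y x^2 otherwise; the hypotheses on f'(0) fix the sign of d.

    The expansion is a martingale argument on a grid of mesh h, with h much smaller
    than eps.  A path is reduced to the pattern of grid cells that contain a
    disruption, which are independent, and the completion time is followed through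
    the state (start of the current task, progress, remaining tasks).  Backward
    induction along the grid shows that any function that is super- (sub-) harmonic
    for one step bounds the expectation from above (below), and [psi], corrected for
    the progress made and with small extra terms, satisfies both one-step
    inequalities.  Beyond the horizon 4S, with S the length of the batch, one uses
    that a block of length S without disruption completes the batch, so that lasting
    longer has probability O(S^4). *)

(** * Completion times along a fixed disruption path *)

Section Path.
Context {R : realType} (N : R -> nat).
Hypothesis N_nd : forall s t, 0 <= s -> s <= t -> (N s <= N t)%N.
Hypothesis N_rc : forall t, 0 <= t -> exists2 e : R, 0 < e &
  forall u, t <= u -> u < t + e -> N u = N t.

(** Right continuity makes the infimum of the times from [t] on with count [N t'] attained, and the
    count is smaller before it. This [r] is the restart time in force at [t']. *)
Lemma last_jump (t t' : R) : 0 <= t -> t <= t' ->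
  exists r, [/\ t <= r, r <= t', N r = N t' & r = t \/ t < r /\ jump N r].
Proof.
move=> t0 tt'.
pose A := [set s | t <= s /\ N s = N t'].
have At' : A t' by [].
have Alb : has_lbound A by exists t => s [].
have Ainf : has_inf A by split; [exists t'|].
have tinf : t <= inf A by apply: lb_le_inf; [exists t'|move=> s []].
have inft' : inf A <= t' by apply: ge_inf.
have inf0 : 0 <= inf A by apply: le_trans tinf.
have Ninf : N (inf A) = N t'.
  have [e e0 eN] := N_rc inf0.
  have [s [ts sN] slt] := inf_adherent e0 Ainf.
  by rewrite -sN eN//; apply: ge_inf.
exists (inf A); split => //.
case: (eqVneq (inf A) t) => [->|ne]; first by left.
right; have lt : t < inf A by rewrite lt_neqAle eq_sym ne.
split => // s s0 sA.
have le1 : (N s <= N (inf A))%N by apply: N_nd => //; exact: ltW.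
rewrite ltn_neqAle le1 andbT; apply/eqP => sN.
have [ts|st] := leP t s.
  have : inf A <= s by apply: ge_inf => //; split; rewrite // sN.
  by rewrite leNgt sA.
have tA : A t.
  split => //; apply/eqP; rewrite eqn_leq N_nd//= -Ninf -sN N_nd//.
  exact: ltW.
have : inf A <= t by apply: ge_inf.
by rewrite leNgt lt.
Qed.

Lemma task_finish_ge (t c : R) : ((t + c)%:E <= task_finish N t c)%E.
Proof.
apply: le_ereal_inf_tmp => _ [r [rt _] <-]; rewrite lee_fin lerD2r.
by case: rt => [->//|[/ltW]].
Qed.

Lemma task_finish_clear (t c : R) : N (t + c) = N t ->
  task_finish N t c = (t + c)%:E.
Proof.
move=> Nt; apply/eqP; rewrite eq_le task_finish_ge andbT.
by apply: ereal_inf_lbound; exists t => //; split => //; left.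
Qed.

(** If the run from [t'] succeeds at once, the restart of the run from [t] in force at [t'] is no
    later and has a clear window, because its count equals [N t']. Otherwise one and the same
    restart serves both runs. *)
Lemma le_task_finish (t t' c : R) : 0 <= t -> t <= t' -> 0 <= c ->
  (task_finish N t c <= task_finish N t' c)%E.
Proof.
move=> t0 tt' c0; apply: le_ereal_inf_tmp => _ [r [[->|[t'r jr]] Nr] <-].
  have [r0 [tr0 r0t' Nr0 r0P]] := last_jump t0 tt'.
  have r00 : 0 <= r0 by apply: le_trans tr0.
  apply: (@le_trans _ _ (r0 + c)%:E); last by rewrite lee_fin lerD2r.
  apply: ereal_inf_lbound; exists r0 => //; split => //.
  apply/eqP; rewrite eqn_leq [X in _ && X]N_nd ?lerDl// andbT Nr0 -Nr.
  by rewrite N_nd ?lerD2r// addr_ge0.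
apply: ereal_inf_lbound; exists r => //; split => //; right; split => //.
exact: le_lt_trans t'r.
Qed.

(** A restart [x < r] cannot succeed, since the jump at [r] lies in its window [(x, x + c]]. Every
    restart from [r] on is also available to the run from [r]. *)
Lemma task_finish_restart (t r c : R) : 0 <= t -> t <= r -> r <= t + c ->
  jump N r -> (task_finish N r c <= task_finish N t c)%E.
Proof.
move=> t0 tr rtc jr; apply: le_ereal_inf_tmp => _ [x [xt Nx] <-].
have tx : t <= x by case: xt => [->//|[/ltW]].
have rxc : r <= x + c by apply: (le_trans rtc); rewrite lerD2r.
apply: ereal_inf_lbound; exists x => //; split => //.
have [rx|xr] := leP r x.
  move: rx; rewrite le_eqVlt => /predU1P[->|rx]; first by left.
  right; split => //; case: xt => [xt|[]//].
  by move: rx; rewrite xt ltNge tr.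
have := jr x (le_trans t0 tx) xr.
by rewrite ltnNge -Nx N_nd// (le_trans t0).
Qed.

(** Lifts a comparison of the first finishing times to the whole batch, both for a later start and
    for a restart. *)
Lemma completion_cons_le (cs : seq R) :
  (forall t t', 0 <= t -> t <= t' -> (completion N t cs <= completion N t' cs)%E) ->
  forall t t' c, 0 <= t -> 0 <= c ->
  (task_finish N t c <= task_finish N t' c)%E ->
  (completion N t (c :: cs) <= completion N t' (c :: cs))%E.
Proof.
move=> mono t t' c t0 c0 /=.
have := task_finish_ge t c.
case: (task_finish N t c) => [r| |]//=; case: (task_finish N t' c) => [r'| |]//=.
- rewrite !lee_fin => tr rr'; apply: mono => //.
  by apply: le_trans tr; rewrite addr_ge0.
- by move=> *; rewrite leey.
Qed.

Lemma le_completion (cs : seq R) : all (fun c => 0 <= c) cs ->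
  forall t t', 0 <= t -> t <= t' -> (completion N t cs <= completion N t' cs)%E.
Proof.
elim: cs => [|c cs IH] /=; first by move=> _ t t' _; rewrite lee_fin.
move=> /andP[c0 cs0] t t' t0 tt'.
by apply: completion_cons_le => //; [exact: IH|exact: le_task_finish].
Qed.

Lemma completion_restart (cs : seq R) (t r c : R) :
  0 <= c -> all (fun c => 0 <= c) cs -> 0 <= t -> t <= r -> r <= t + c ->
  jump N r -> (completion N r (c :: cs) <= completion N t (c :: cs))%E.
Proof.
move=> c0 cs0 t0 tr rtc jr; apply: completion_cons_le => //.
- exact: le_completion.
- exact: le_trans tr.
- exact: task_finish_restart.
Qed.

Lemma completion_clear (cs : seq R) (t c : R) : N (t + c) = N t ->
  completion N t (c :: cs) = completion N (t + c) cs.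
Proof. by move=> Nt /=; rewrite task_finish_clear. Qed.

Lemma completion_cons_ge (cs : seq R) (t c : R) :
  0 <= c -> all (fun c => 0 <= c) cs -> 0 <= t ->
  (completion N (t + c) cs <= completion N t (c :: cs))%E.
Proof.
move=> c0 cs0 t0 /=; have := task_finish_ge t c.
case: (task_finish N t c) => [r| |]//=; last by move=> _; exact: leey.
by rewrite lee_fin => tr; apply: le_completion => //; rewrite addr_ge0.
Qed.

Lemma completion_ge (cs : seq R) (t : R) : all (fun c => 0 <= c) cs -> 0 <= t ->
  (t%:E <= completion N t cs)%E.
Proof.
elim: cs t => [//|c cs IH] t /andP[c0 cs0] t0.
apply: le_trans (completion_cons_ge c0 cs0 t0).
by apply: le_trans (IH _ cs0 (addr_ge0 t0 c0)); rewrite lee_fin lerDl.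
Qed.

Lemma completion_all_clear (cs : seq R) (t : R) :
  all (fun c => 0 <= c) cs -> 0 <= t -> N (t + \sum_(c <- cs) c) = N t ->
  completion N t cs = (t + \sum_(c <- cs) c)%:E.
Proof.
elim: cs t => [|c cs IH] t; first by rewrite big_nil addr0.
move=> /andP[c0 cs0] t0; rewrite big_cons addrA => Nt.
have S0 : 0 <= \sum_(j <- cs) j.
  by rewrite big_seq; apply: sumr_ge0 => x /(allP cs0).
have Nc : N (t + c) = N t.
  apply/eqP; rewrite eqn_leq [X in _ && X]N_nd ?lerDl// andbT -Nt.
  by rewrite N_nd ?lerDl// addr_ge0.
by rewrite completion_clear// IH ?Nc// ?addr_ge0.
Qed.

(** By monotonicity in the start, throwing everything away and starting the batch afresh at [t] only
    delays it, and the fresh batch runs through undisturbed. *)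
Lemma completion_le_clear_block (cs : seq R) (t : R) :
  all (fun c => 0 <= c) cs -> 0 <= t -> N (t + \sum_(c <- cs) c) = N t ->
  (completion N 0 cs <= (t + \sum_(c <- cs) c)%:E)%E.
Proof.
by move=> cs0 t0 Nt; rewrite -completion_all_clear// le_completion.
Qed.

End Path.

(* Unlike [ge0_le_integral], no measurability is asked of [f1] and [f2]: the
   integral of a nonnegative function is a supremum over simple functions below it. *)
Lemma ge0_le_integral_nomeas d (T : measurableType d) (R : realType)
    (mu : {measure set T -> \bar R}) (D : set T) (f1 f2 : T -> \bar R) :
  (forall x, D x -> 0 <= f1 x)%E -> (forall x, D x -> f1 x <= f2 x)%E ->
  (\int[mu]_(x in D) f1 x <= \int[mu]_(x in D) f2 x)%E.
Proof.
move=> f10 f12; rewrite !ge0_integralE//; last first.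
  by move=> x Dx; exact: le_trans (f10 x Dx) (f12 x Dx).
apply: ereal_sup_le => _ [h hf <-]; exists h => // x.
apply: le_trans (hf x) _; rewrite /patch; case: ifPn => // xD.
by apply: f12; exact: set_mem.
Qed.

(** * Bounds on the mean measure *)

Section MeanMeasure.
Context {R : realType}.
Variable lam : R -> R.

(** Comparison with the constants [a] and [b] at the level of extended integrals, where [0 <= a]
    makes the integrand nonnegative. *)
Lemma mean_meas_bounds (s t a b : R) : s <= t -> 0 <= a ->
  (forall x, s < x -> x <= t -> a <= lam x <= b) ->
  a * (t - s) <= mean_meas lam s t <= b * (t - s).
Proof.
move=> st a0 ab.
have lam0 x : `]s, t]%classic x -> (0 <= (lam x)%:E)%E.
  rewrite /= in_itv/= => /andP[sx xt]; rewrite lee_fin.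
  by have /andP[/(le_trans a0)] := ab x sx xt.
have mitv : measurable (`]s, t]%classic : set R) by exact: measurable_itv.
have cstE (k : R) : (\int[@lebesgue_measure R]_(x in `]s, t]) k%:E = (k * (t - s))%:E)%E.
  rewrite integral_cst//= lebesgue_measure_itv/= lte_fin.
  case: ltP => [_|ts]; first by rewrite -EFinD -EFinM.
  by have -> : t = s by [apply/eqP; rewrite eq_le ts st]; rewrite subrr mulr0 mule0.
have lo : ((a * (t - s))%:E <= \int[@lebesgue_measure R]_(x in `]s, t]) (lam x)%:E)%E.
  rewrite -cstE; apply: ge0_le_integral_nomeas => x; first by rewrite lee_fin.
  by rewrite /= in_itv/= => /andP[sx xt]; have /andP[] := ab x sx xt.
have hi : (\int[@lebesgue_measure R]_(x in `]s, t]) (lam x)%:E <= (b * (t - s))%:E)%E.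
  rewrite -cstE; apply: ge0_le_integral_nomeas => x; first exact: lam0.
  by rewrite /= in_itv/= => /andP[sx xt]; have /andP[] := ab x sx xt.
rewrite /mean_meas /Rintegral.
(* The two bounds exclude infinite values, which [fine] would send to 0. *)
move: lo hi; case: (integral _ _ _) => [r| |]//=; rewrite !lee_fin.
by move=> -> ->.
Qed.

End MeanMeasure.

(** * Independence of the clear and disrupted grid cells *)

Section Pattern.
Context d (T : measurableType d) (R : realType) (P : probability T R).
Context (lam : R -> R) (N : T -> R -> nat).
Hypothesis NP : is_nhpp P lam N.
Variable h : R.
Hypothesis h0 : 0 <= h.
Hypothesis lam0 : forall x, 0 < x -> 0 <= lam x.
Variable B : R.
Hypothesis lamB : forall x, 0 < x -> lam x <= B.

Let t (k : nat) : R := k%:R * h.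

Definition cell_mean (k : nat) := mean_meas lam (t k) (t k.+1).

Lemma cell_mean_ge0 k : 0 <= cell_mean k.
Proof.
have := @mean_meas_bounds _ lam (t k) (t k.+1) 0 B.
rewrite mul0r => /(_ _ (lexx _) _)/andP[]//.
- by rewrite ler_wpM2r// ler_nat.
- move=> x tx _; have x0 : 0 < x by apply: le_lt_trans tx; rewrite mulr_ge0.
  by rewrite lam0//= lamB.
Qed.

Definition cell_clear (k : nat) : set T := [set w | N w (t k.+1) = N w (t k)].

Let t_le k : t k <= t k.+1.
Proof. by rewrite ler_wpM2r// ler_nat. Qed.

Let t_ge0 k : 0 <= t k. Proof. by rewrite mulr_ge0. Qed.

Lemma measurable_cell_inc k j :
  measurable [set w | (N w (t k.+1) - N w (t k))%N = j].
Proof.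
case: NP => _ _ _ mN _.
(* Only the level sets of the counts are known to be measurable, so the event is split by the counts
   at both ends of the cell. *)
rewrite (_ : mkset _ = \bigcup_i ([set w | N w (t k) = i] `&`
    \bigcup_l (if (l - i)%N == j then [set w | N w (t k.+1) = l] else set0))).
  apply: bigcupT_measurable => i; apply: measurableI; first exact: mN.
  by apply: bigcupT_measurable => l; case: ifP => // _; exact: mN.
apply/seteqP; split => w /=.
  move=> wj; exists (N w (t k)) => //; split => //.
  by exists (N w (t k.+1)) => //; rewrite wj eqxx.
by move=> [i _ [<-]] [l _]; case: ifP => //= /eqP <- <-.
Qed.

Lemma cell_clearE k : cell_clear k = [set w | (N w (t k.+1) - N w (t k))%N = 0%N].
Proof.
case: NP => _ nd _ _ _; apply/seteqP; split => w; rewrite /cell_clear/=.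
  by move=> ->; rewrite subnn.
move=> /eqP; rewrite subn_eq0 => le1; apply/eqP; rewrite eqn_leq le1/=.
exact: nd.
Qed.

Definition cell_event (k : nat) (x : bool) : set T :=
  if x then cell_clear k else ~` cell_clear k.

Lemma measurable_cell_event k x : measurable (cell_event k x).
Proof.
have mc : measurable (cell_clear k) by rewrite cell_clearE; exact: measurable_cell_inc.
by case: x => //; exact: measurableC.
Qed.

Definition cell_prob (k : nat) (x : bool) : R :=
  if x then expR (- cell_mean k) else 1 - expR (- cell_mean k).

Lemma pois_pmf_ge0 (m : R) k : 0 <= m -> 0 <= pois_pmf m k.
Proof. by move=> m0; rewrite /pois_pmf mulr_ge0 ?expR_ge0// divr_ge0// exprn_ge0. Qed.

Lemma pois_pmf0 (m : R) : pois_pmf m 0 = expR (- m).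
Proof. by rewrite /pois_pmf expr0 fact0 divr1 mul1r. Qed.

Lemma nneseries_pois_pmf (m : R) : 0 <= m ->
  (\sum_(k <oo) (pois_pmf m k)%:E = 1)%E.
Proof.
move=> m0.
rewrite [RHS](_ : _ = (expR (- m))%:E * (expR m)%:E)%E; last first.
  by rewrite -EFinM expRN mulVf ?gt_eqF ?expR_gt0.
under eq_eseriesr.
  move=> n _; rewrite /pois_pmf mulrC EFinM; over.
rewrite /= nneseriesZl/=; last first.
  by move=> n _; rewrite lee_fin divr_ge0// exprn_ge0.
congr (_ * _)%E; rewrite expRE -EFin_lim; last first.
  rewrite /pseries/=; under eq_fun do rewrite mulrC.
  exact: is_cvg_series_exp_coeff.
apply/congr_lim/funext => n/=; rewrite /pseries/= /series/= -sumEFin//.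
by under eq_bigr do rewrite mulrC.
Qed.

(** Total mass 1 without the atom at 0: the probability of at least one disruption. *)
Lemma nneseries_pois_pmfS (m : R) : 0 <= m ->
  (\sum_(k <oo) (pois_pmf m k.+1)%:E = (1 - expR (- m))%:E)%E.
Proof.
move=> m0; have := nneseries_pois_pmf m0.
rewrite nneseries_recl//; last by move=> k _; rewrite lee_fin pois_pmf_ge0.
rewrite pois_pmf0 => /esym H.
rewrite EFinB H addeAC subee// add0e -(@nneseries_addn _ _ 1).
  by apply: eq_eseriesr => k _; rewrite addn1.
by move=> k; rewrite lee_fin pois_pmf_ge0.
Qed.

(* Cells before [j] only record whether they are clear, the others their exact count. *)
Definition mixed_event (b : nat -> bool) (ks : nat -> nat) (j i : nat) : set T :=
  if (i < j)%N then cell_event i (b i)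
  else [set w | (N w (t i.+1) - N w (t i))%N = ks i].

Lemma measurable_mixed_event b ks j i : measurable (mixed_event b ks j i).
Proof.
rewrite /mixed_event; case: ifP => _; first exact: measurable_cell_event.
exact: measurable_cell_inc.
Qed.

(** [is_nhpp] gives joint probabilities of exact counts. Induction on [j] converts one cell at a
    time: clear means count 0, and disrupted is the disjoint union of the counts [k.+1], whose
    masses add up by [nneseries_pois_pmfS]. *)
Lemma prob_mixed_event (b : nat -> bool) (n j : nat) (ks : nat -> nat) : (j <= n)%N ->
  P (\bigcap_(i in `I_n) mixed_event b ks j i) =
  (\prod_(i < n) if (i < j)%N then cell_prob i (b i)
                 else pois_pmf (cell_mean i) (ks i))%:E.
Proof.
elim: j ks => [|j IH] ks jn.
  by case: NP => _ _ _ _ /(_ n t ks (t_ge0 0) t_le).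
(* Prescribing the count [k] in cell [j] brings the event into the form of the induction
   hypothesis. *)
pose upd k i := if i == j then k else ks i.
have updE k i : (i < n)%N -> mixed_event b (upd k) j i =
    if i == j then [set w | (N w (t i.+1) - N w (t i))%N = k]
    else mixed_event b ks j.+1 i.
  move=> _; rewrite /mixed_event /upd [in RHS]ltnS [in RHS]leq_eqVlt.
  by case: (eqVneq i j) => [->|ij] /=; rewrite ?ltnn.
have prodE k : (\prod_(i < n) if (i < j)%N then cell_prob i (b i)
      else pois_pmf (cell_mean i) (upd k i)) = pois_pmf (cell_mean j) k *
    \prod_(i < n | i != Ordinal jn) if (i < j.+1)%N then cell_prob i (b i)
                 else pois_pmf (cell_mean i) (ks i).
  rewrite (bigD1 (Ordinal jn))//= ltnn /upd eqxx; congr (_ * _).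
  apply: eq_bigr => i /negPf ij; have ij' : (i == j :> nat) = false by exact: ij.
  by rewrite [in RHS]ltnS [in RHS]leq_eqVlt ij'.
have prodj : (\prod_(i < n) if (i < j.+1)%N then cell_prob i (b i)
      else pois_pmf (cell_mean i) (ks i)) = cell_prob j (b j) *
    \prod_(i < n | i != Ordinal jn) if (i < j.+1)%N then cell_prob i (b i)
                 else pois_pmf (cell_mean i) (ks i).
  by rewrite (bigD1 (Ordinal jn))//= ltnSn.
rewrite prodj; set Q := \prod_(i < n | i != Ordinal jn) _.
have Q0 : 0 <= Q.
  apply: prodr_ge0 => i _; case: ifP => _; last exact/pois_pmf_ge0/cell_mean_ge0.
  rewrite /cell_prob; case: (b i); first exact: expR_ge0.
  by rewrite subr_ge0 -expR0 ler_expR oppr_le0 cell_mean_ge0.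
have [bj|bj] := boolP (b j).
  rewrite -[cell_prob j true]pois_pmf0 -prodE -IH ?(ltnW jn)//.
  congr (P _); apply: eq_bigcapr => i /= ilt; rewrite updE//.
  case: eqP => // ->; rewrite /mixed_event ltnSn bj.
  by rewrite [cell_event _ _]cell_clearE.
rewrite /cell_prob EFinM -nneseries_pois_pmfS; last exact: cell_mean_ge0.
rewrite muleC -nneseriesZl; last first.
  by move=> k _; rewrite lee_fin pois_pmf_ge0// cell_mean_ge0.
under eq_eseriesr do rewrite -EFinM mulrC -prodE -IH ?(ltnW jn)//.
have mF k : measurable (\bigcap_(i in `I_n) mixed_event b (upd k.+1) j i).
  by apply: bigcap_measurableType => i _; exact: measurable_mixed_event.
rewrite -measure_semi_bigcup//=; last 2 first.
- apply/trivIsetP => k l _ _ kl; apply/seteqP; split => // w [/= /(_ j jn) + /(_ j jn)].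
  rewrite !updE// eqxx /= => -> [] /eqP.
  by rewrite (negPf kl).
- by apply: bigcupT_measurable.
congr (P _); apply/seteqP; split => w /=.
  move=> H; have := H j jn; rewrite /mixed_event ltnSn (negPf bj) /cell_event cell_clearE/=.
  case E : (N w (t j.+1) - N w (t j))%N => [//|k] _.
  exists k => // i /= ilt; change (mixed_event b (upd k.+1) j i w); rewrite updE//; case: eqP => [->|_]//.
  exact: H.
move=> [k _ H] i /= ilt; have := H i ilt; rewrite updE//.
case: eqP => // -> /= Hk; rewrite /mixed_event ltnSn (negPf bj) /cell_event cell_clearE/=.
by rewrite Hk.
Qed.

Definition pattern (b : seq bool) : set T :=
  \bigcap_(i in `I_(size b)) cell_event i (nth true b i).

Lemma measurable_pattern b : measurable (pattern b).
Proof. by apply: bigcap_measurableType => i _; exact: measurable_cell_event. Qed.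

Lemma prob_pattern b : P (pattern b) =
  (\prod_(i < size b) cell_prob i (nth true b i))%:E.
Proof.
have := @prob_mixed_event (nth true b) (size b) (size b) (fun=> 0%N) (leqnn _).
rewrite (_ : bigcap _ _ = pattern b); last first.
  by apply: eq_bigcapr => i /= ib; rewrite /mixed_event ib.
by move=> ->; congr (_%:E); apply: eq_bigr => i _; rewrite ltn_ord.
Qed.

Lemma patternS b x : pattern (rcons b x) = pattern b `&` cell_event (size b) x.
Proof.
rewrite /pattern size_rcons; apply/seteqP; split => w /=.
  move=> H; split.
    by move=> i /= ib; have := H i (ltnW ib); rewrite nth_rcons ib.
  by have := H (size b) (ltnSn _); rewrite nth_rcons ltnn eqxx.
move=> [H1 H2] i /=; rewrite ltnS leq_eqVlt nth_rcons => /predU1P[->|ib].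
  by rewrite ltnn eqxx.
by rewrite ib; exact: H1.
Qed.

Lemma prob_patternS b x :
  P (pattern (rcons b x)) = (P (pattern b) * (cell_prob (size b) x)%:E)%E.
Proof.
rewrite !prob_pattern size_rcons big_ord_recr/= EFinM nth_rcons ltnn eqxx.
congr (_%:E * _)%E; apply: eq_bigr => i _; by rewrite nth_rcons ltn_ord.
Qed.

End Pattern.

(** * Backward induction along the grid *)

Section Recursion.
Context d (T : measurableType d) (R : realType) (P : probability T R).
Context (lam : R -> R) (N : T -> R -> nat).
Hypothesis NP : is_nhpp P lam N.
Variable h : R.
Hypothesis h_gt0 : 0 < h.
Hypothesis lam0 : forall x, 0 < x -> 0 <= lam x.
Variable B : R.
Hypothesis lamB : forall x, 0 < x -> lam x <= B.
Variable cs0 : seq R.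

Let h0 : 0 <= h := ltW h_gt0.
Let t (k : nat) : R := k%:R * h.
Let tS k : t k.+1 = t k + h. Proof. by rewrite /t -natr1 mulrDl mul1r. Qed.
Let t_ge0 k : 0 <= t k. Proof. by rewrite mulr_ge0. Qed.

Local Notation pat := (pattern N h).
Local Notation q k x := (cell_prob lam h k x).
Local Notation C w s cs := (completion (N w) s cs).

Let Nnd w s s' : 0 <= s -> s <= s' -> (N w s <= N w s')%N.
Proof. by case: NP => _ nd _ _ _; exact: nd. Qed.

Let Nrc w s : 0 <= s ->
  exists2 e : R, 0 < e & forall u, s <= u -> u < s + e -> N w u = N w s.
Proof. by case: NP => _ _ rc _ _; exact: rc. Qed.

Let mpat b : measurable (pat b). Proof. exact: (measurable_pattern NP h0). Qed.

Let Ppat b : exists2 x : R, 0 <= x & P (pat b) = x%:E.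
Proof.
by exists (fine (P (pat b))); [exact: fine_ge0|rewrite fineK// fin_num_measure].
Qed.

Let PpatS b x : P (pat (rcons b x)) = (P (pat b) * (q (size b) x)%:E)%E.
Proof. exact: (prob_patternS NP h0 lam0 lamB b x). Qed.

Let pat_split b w : pat b w -> pat (rcons b true) w \/ pat (rcons b false) w.
Proof.
move=> bw; rewrite !patternS.
by case: (pselect (cell_clear N h (size b) w)) => H; [left|right].
Qed.

(* [X] need not be measurable, hence the measurable [g]. *)
Definition upper_bound_on b (X : T -> \bar R) (u : R) : Prop :=
  exists g : T -> R, [/\ measurable_fun setT g, forall w, 0 <= g w,
    forall w, pat b w -> (X w <= (g w)%:E)%E &
    (\int[P]_w (g w)%:E <= P (pat b) * u%:E)%E].

(** In contrast to [upper_bound_on], the witness vanishes off the pattern, so that the sum of the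
    witnesses of the two refined patterns still lies below [X]. *)
Definition lower_bound_on b (X : T -> \bar R) (u : R) : Prop :=
  exists g : T -> R, [/\ measurable_fun setT g, forall w, 0 <= g w,
    forall w, ~ pat b w -> g w = 0,
    forall w, pat b w -> ((g w)%:E <= X w)%E &
    (P (pat b) * u%:E <= \int[P]_w (g w)%:E)%E].

Let integral_indic_pat b (x : R) : 0 <= x ->
  (\int[P]_w (x * \1_(pat b) w)%:E = P (pat b) * x%:E)%E.
Proof.
move=> x0; rewrite (integralZl_indic measurableT (fun=> pat b))//.
  by rewrite integral_indic// setIT muleC.
by rewrite ltNge x0.
Qed.

Let measurable_indic_pat b (x : R) :
  measurable_fun setT (fun w => x * \1_(pat b) w).
Proof. by apply: measurable_funM => //; exact: measurable_indic. Qed.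

Lemma upper_bound_on_cst b X x u : 0 <= x -> x <= u ->
  (forall w, pat b w -> (X w <= x%:E)%E) -> upper_bound_on b X u.
Proof.
move=> x0 xu Xx; exists (fun w => x * \1_(pat b) w); split.
- exact: measurable_indic_pat.
- by move=> w; rewrite mulr_ge0.
- by move=> w bw; rewrite indicE mem_set//= mulr1; exact: Xx.
- rewrite integral_indic_pat//; have [y y0 ->] := Ppat b.
  by rewrite -!EFinM lee_fin ler_wpM2l.
Qed.

Lemma lower_bound_on_cst b X x u : 0 <= x -> u <= x ->
  (forall w, pat b w -> (x%:E <= X w)%E) -> lower_bound_on b X u.
Proof.
move=> x0 ux Xx; exists (fun w => x * \1_(pat b) w); split.
- exact: measurable_indic_pat.
- by move=> w; rewrite mulr_ge0.
- by move=> w bw; rewrite indicE memNset//= mulr0.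
- by move=> w bw; rewrite indicE mem_set//= mulr1; exact: Xx.
- rewrite integral_indic_pat//; have [y y0 ->] := Ppat b.
  by rewrite -!EFinM lee_fin ler_wpM2l.
Qed.

Let integralD_fun (g1 g2 : T -> R) :
  measurable_fun setT g1 -> (forall w, 0 <= g1 w) ->
  measurable_fun setT g2 -> (forall w, 0 <= g2 w) ->
  (\int[P]_w (g1 w + g2 w)%:E = \int[P]_w (g1 w)%:E + \int[P]_w (g2 w)%:E)%E.
Proof.
move=> m1 g10 m2 g20; under eq_integral do rewrite EFinD.
have m1' : measurable_fun setT (EFin \o g1) by exact/measurable_EFinP.
have m2' : measurable_fun setT (EFin \o g2) by exact/measurable_EFinP.
by rewrite ge0_integralD//= => w _; rewrite lee_fin.
Qed.

(** The sum of two nonnegative witnesses dominates each of them, hence bounds [X] whichever way the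
    next cell turns out; [PpatS] supplies the weights. *)
Lemma upper_bound_on_step b X u1 u0 u :
  upper_bound_on (rcons b true) X u1 -> upper_bound_on (rcons b false) X u0 ->
  q (size b) true * u1 + q (size b) false * u0 <= u -> upper_bound_on b X u.
Proof.
move=> [g1 [m1 g10 Xg1 I1]] [g2 [m2 g20 Xg2 I2]] uu.
exists (fun w => g1 w + g2 w); split.
- exact: measurable_funD.
- by move=> w; rewrite addr_ge0.
- move=> w /pat_split[/Xg1|/Xg2] /le_trans; apply; rewrite lee_fin.
    by rewrite lerDl.
  by rewrite lerDr.
- rewrite integralD_fun//; apply: (le_trans (leeD I1 I2)).
  rewrite !PpatS; have [y y0 ->] := Ppat b.
  by rewrite -!EFinM -EFinD lee_fin -!mulrA -mulrDr ler_wpM2l.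
Qed.

Lemma lower_bound_on_step b X u1 u0 u :
  lower_bound_on (rcons b true) X u1 -> lower_bound_on (rcons b false) X u0 ->
  u <= q (size b) true * u1 + q (size b) false * u0 -> lower_bound_on b X u.
Proof.
move=> [g1 [m1 g10 z1 Xg1 I1]] [g2 [m2 g20 z2 Xg2 I2]] uu.
exists (fun w => g1 w + g2 w); split.
- exact: measurable_funD.
- by move=> w; rewrite addr_ge0.
- move=> w bw; rewrite z1 ?z2 ?addr0//.
    by rewrite patternS => -[].
  by rewrite patternS => -[].
- move=> w bw; case: (pat_split bw) => bw'.
    rewrite z2 ?addr0; first exact: Xg1.
    by move: bw'; rewrite !patternS => -[_ c] [_ /=].
  rewrite z1 ?add0r; first exact: Xg2.
  by move: bw'; rewrite !patternS => -[_ /= c] [_ /=].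
- rewrite integralD_fun//; apply: le_trans (leeD I1 I2).
  rewrite !PpatS; have [y y0 ->] := Ppat b.
  by rewrite -!EFinM -EFinD lee_fin -!mulrA -mulrDr ler_wpM2l.
Qed.

Let sandwich w s x s' : 0 <= s -> s <= x -> x <= s' -> N w s' = N w s ->
  N w x = N w s.
Proof.
move=> s0 sx xs' e; apply/eqP; rewrite eqn_leq [X in _ && X]Nnd// andbT -e.
by apply: Nnd => //; exact: le_trans sx.
Qed.

Let all_ge0 cs : all (fun c => h < c) cs -> all (fun c => 0 <= c) cs.
Proof. by apply: sub_all => c /ltW; exact: le_trans. Qed.

(* [(s, p, c :: cs)]: the task of length [c] was started at time [s], has been
   processed for [p] units, and is followed by the tasks [cs]. *)
Definition state_ok (S s p c : R) (cs : seq R) : Prop :=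
  [/\ 0 <= s, 0 <= p, p < c, all (fun c => h < c) (c :: cs) &
      \sum_(x <- c :: cs) x <= S].

Section Upper.
Variables (S : R) (K : nat) (U : R -> R -> seq R -> R).
Let L : R := t K.
Hypothesis U_nil : forall s p, 0 <= s -> s + p <= L -> s <= U s p [::].
Hypothesis U_end : forall s p c cs, state_ok S s p c cs -> s + p = L ->
  L <= U s p (c :: cs).
Hypothesis U_run : forall k s p c cs, (k < K)%N -> s + p = t k ->
  state_ok S s p c cs -> p + h < c ->
  q k true * U s (p + h) (c :: cs) + q k false * U (s + p + h) 0 (c :: cs)
  <= U s p (c :: cs).
Hypothesis U_cross : forall k s p c cs, (k < K)%N -> s + p = t k ->
  state_ok S s p c cs -> c <= p + h ->
  q k true * U (s + c) (p + h - c) cs + q k false * U (s + p + h) 0 (c :: cs)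
  <= U s p (c :: cs).

(** Invariant: the batch is no later than [cs] started afresh at [s], and [(s, s + p]] is clear. A
    disruption in the next cell is moved to the end of that cell: by [le_completion], a restart at
    [s + p + h] without progress can only be later than the true one. *)
Lemma upper_recursion j b s p cs : (size b + j = K)%N ->
  s + p = t (size b) -> 0 <= s -> 0 <= p ->
  (forall c cs', cs = c :: cs' -> p < c) ->
  all (fun c => h < c) cs -> \sum_(x <- cs) x <= S ->
  (forall w, pat b w -> (C w 0 cs0 <= C w s cs)%E /\ N w (s + p) = N w s) ->
  upper_bound_on b (fun w => mine (C w 0 cs0) L%:E) (U s p cs).
Proof.
elim: j b s p cs => [|j IH] b s p [|c cs] bK sp s0 p0 pc hcs Scs H.
- apply: (@upper_bound_on_cst _ _ s) => //.
    by apply: U_nil => //; rewrite sp /L -bK addn0.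
  by move=> w /H[Cs _]; rewrite ge_min Cs.
- apply: (@upper_bound_on_cst _ _ L) => //; first exact: t_ge0.
    by apply: U_end; [split => //; exact: pc|rewrite sp /L -bK addn0].
  by move=> w _; rewrite ge_min lexx orbT.
- apply: (@upper_bound_on_cst _ _ s) => //.
    by apply: U_nil => //; rewrite sp /L /t ler_wpM2r// ler_nat -bK leq_addr.
  by move=> w /H[Cs _]; rewrite ge_min Cs.
have pc' : p < c by exact: pc.
have c0 : 0 <= c by apply: le_trans p0 (ltW _).
have bK' x : (size (rcons b x) + j = K)%N by rewrite size_rcons addSn -addnS.
have kK : (size b < K)%N by rewrite -bK addnS ltnS leq_addr.
have tb x : t (size (rcons b x)) = s + p + h by rewrite size_rcons tS sp.
have sph : s <= s + p + h by rewrite -addrA lerDl addr_ge0.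
have bad : upper_bound_on (rcons b false) (fun w => mine (C w 0 cs0) L%:E)
    (U (s + p + h) 0 (c :: cs)).
  apply: IH => //.
  - by rewrite tb addr0.
  - exact: le_trans sph.
  - by move=> c' cs' [<- _]; exact: le_lt_trans pc'.
  - move=> w; rewrite patternS addr0 => -[/H[Cs _] _]; split => //.
    apply: le_trans Cs _; apply: le_completion => //.
    + exact: Nnd.
    + exact: Nrc.
    + exact: all_ge0.
have st : state_ok S s p c cs by split.
have good w : pat (rcons b true) w -> (C w 0 cs0 <= C w s (c :: cs))%E /\
    N w (s + p + h) = N w s.
  rewrite patternS => -[/H[Cs Ns]]; rewrite /cell_event /cell_clear /=.
  by rewrite -!/(t _) tS -sp => ->.
have [phc|phc] := ltP (p + h) c.
  apply: (upper_bound_on_step _ bad (U_run kK sp st phc)).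
  apply: IH => //.
  - by rewrite addrA tb.
  - by rewrite addr_ge0.
  - by move=> c' cs' [<- _].
  - by move=> w; rewrite addrA; exact: good.
apply: (upper_bound_on_step _ bad (U_cross kK sp st phc)).
move: hcs Scs => /= /andP[hc hcs]; rewrite big_cons => Scs.
apply: IH => //.
- by rewrite tb; ring.
- by rewrite addr_ge0.
- by rewrite subr_ge0.
- move=> c' cs' e; move: hcs; rewrite e /= => /andP[hc' _].
  by apply: le_lt_trans hc'; rewrite lerBlDr addrC lerD2l ltW.
- by apply: le_trans Scs; rewrite lerDr.
- move=> w /good[Cs Ns].
  have Nc : N w (s + c) = N w s.
    apply: (@sandwich _ _ _ (s + p + h)) => //; first by rewrite lerDl.
    by rewrite -addrA lerD2l.
  rewrite (_ : s + c + (p + h - c) = s + p + h); last by ring.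
  by rewrite Ns Nc -completion_clear.
Qed.

End Upper.

Section Lower.
Variables (S : R) (K : nat) (U : R -> R -> seq R -> R) (X : T -> \bar R) (M : R).
Let L : R := t K.
Hypothesis M0 : 0 <= M.
Hypothesis CX : forall w, (C w 0 cs0 <= X w)%E.
Hypothesis X_late : forall w, (L%:E < C w 0 cs0)%E -> ((L + M)%:E <= X w)%E.
Hypothesis U_nil : forall s p, 0 <= s -> s + p <= L -> U s p [::] <= s.
Hypothesis U_end : forall s p c cs, state_ok S s p c cs -> s + p = L ->
  U s p (c :: cs) <= L + M.
Hypothesis U_run : forall k s p c cs, (k < K)%N -> s + p = t k ->
  state_ok S s p c cs -> p + h < c ->
  U s p (c :: cs) <=
  q k true * U s (p + h) (c :: cs) + q k false * U (s + p) h (c :: cs).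
Hypothesis U_cross : forall k s p c cs, (k < K)%N -> s + p = t k ->
  state_ok S s p c cs -> c <= p + h ->
  U s p (c :: cs) <=
  q k true * U (s + c) (p + h - c) cs + q k false * U (s + p) h cs.

(* The current task was started at some [r >= s]; the recursion credits it with
   all the progress possible. *)
Let covers (s p : R) (cs : seq R) (w : T) : Prop :=
  if cs is [::] then (s%:E <= C w 0 cs0)%E
  else exists r, [/\ s <= r, r <= s + p, N w r = N w (s + p) &
                     (C w r cs <= C w 0 cs0)%E].

(** A disruption in the next cell is moved to the beginning of that cell, and the whole cell is
    credited as progress. If the current task might have ended in the cell, it even counts as done
    and the next one as running since [s + p]. At the horizon [U] may exceed [L] by [M], which [X]
    makes up for on unfinished paths. *)
Lemma lower_recursion j b s p cs : (size b + j = K)%N ->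
  s + p = t (size b) -> 0 <= s -> 0 <= p ->
  (forall c cs', cs = c :: cs' -> p < c) ->
  all (fun c => h < c) cs -> \sum_(x <- cs) x <= S ->
  (forall w, pat b w -> covers s p cs w) ->
  lower_bound_on b X (U s p cs).
Proof.
elim: j b s p cs => [|j IH] b s p [|c cs] bK sp s0 p0 pc hcs Scs H.
- apply: (@lower_bound_on_cst _ _ s) => //.
    by apply: U_nil => //; rewrite sp /L -bK addn0.
  by move=> w /H Cs; exact: le_trans Cs (CX w).
- apply: (@lower_bound_on_cst _ _ (L + M)).
  - by rewrite addr_ge0// /L.
  - by apply: U_end; [split => //; exact: pc|rewrite sp /L -bK addn0].
  - move=> w /H[r [sr rsp _ rC]]; apply: X_late.
    move: hcs => /= /andP[/ltW hc /all_ge0 cs0'].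
    apply: lt_le_trans rC.
    apply: (@lt_le_trans _ _ (r + c)%:E).
      rewrite lte_fin /L -bK addn0 -sp.
      by apply: ler_ltD => //; exact: pc.
    have c0 : 0 <= c by exact: le_trans hc.
    have r0 : 0 <= r by exact: le_trans sr.
    apply: le_trans (completion_cons_ge (@Nnd w) (@Nrc w) c0 cs0' r0).
    by apply: (completion_ge (@Nnd w) (@Nrc w) cs0'); rewrite addr_ge0.
- apply: (@lower_bound_on_cst _ _ s) => //.
    by apply: U_nil => //; rewrite sp /L /t ler_wpM2r// ler_nat -bK leq_addr.
  by move=> w /H Cs; exact: le_trans Cs (CX w).
have pc' : p < c by exact: pc.
have c0 : 0 <= c by apply: le_trans p0 (ltW _).
have bK' x : (size (rcons b x) + j = K)%N by rewrite size_rcons addSn -addnS.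
have kK : (size b < K)%N by rewrite -bK addnS ltnS leq_addr.
have tb x : t (size (rcons b x)) = s + p + h by rewrite size_rcons tS sp.
have st : state_ok S s p c cs by split.
have sp0 : 0 <= s + p by exact: addr_ge0.
have sph : s + p <= s + p + h by rewrite lerDl.
have cs0' : all (fun c => 0 <= c) cs by move: hcs => /= /andP[_ /all_ge0].
have last w := last_jump (@Nnd w) (@Nrc w) sp0 sph.
have good w : pat (rcons b true) w -> exists r, [/\ s <= r, r <= s + p,
    N w r = N w (s + p + h) & (C w r (c :: cs) <= C w 0 cs0)%E].
  rewrite patternS => -[/H[r [sr rsp Nr rC]]]; rewrite /cell_event /cell_clear /=.
  by rewrite -!/(t _) tS -sp => ->; exists r.
have [phc|phc] := ltP (p + h) c.
  apply: (lower_bound_on_step _ _ (U_run kK sp st phc)).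
    apply: IH => //.
    - by rewrite addrA tb.
    - by rewrite addr_ge0.
    - by move=> c' cs' [<- _].
    - move=> w /good[r [sr rsp Nr rC]]; exists r; split => //.
        by rewrite addrA; exact: le_trans sph.
      by rewrite addrA.
  apply: IH => //.
  - by move=> c' cs' [<- _]; apply: le_lt_trans phc; rewrite lerDr.
  - move=> w; rewrite patternS => -[/H[r [sr rsp Nr rC]]] /= bad.
    have [r' [spr' r'sph Nr' r'P]] := last w.
    exists r'; split => //.
    apply: le_trans rC; case: r'P => [r'E|[spr jr']].
      (* A last restart at [s + p] would mean an unchanged count over the cell. *)
      case: bad; rewrite /cell_clear /= -!/(t _) tS -sp -Nr'.
      by rewrite r'E.
    apply: (completion_restart (@Nnd w) (@Nrc w)) => //.
    + exact: le_trans sr.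
    + by apply: le_trans spr'.
    + apply: (le_trans r'sph); rewrite -addrA; apply: lerD => //.
      exact: ltW.
apply: (lower_bound_on_step _ _ (U_cross kK sp st phc)).
  move: hcs Scs => /= /andP[hc hcs]; rewrite big_cons => Scs.
  apply: IH => //.
  - by rewrite tb; ring.
  - by rewrite addr_ge0.
  - by rewrite subr_ge0.
  - move=> c' cs' e; move: hcs; rewrite e /= => /andP[hc' _].
    by apply: le_lt_trans hc'; rewrite lerBlDr addrC lerD2l ltW.
  - by apply: le_trans Scs; rewrite lerDr.
  - move=> w /good[r [sr rsp Nr rC]].
    have r0 : 0 <= r by exact: le_trans sr.
    have rcC : (C w (r + c) cs <= C w 0 cs0)%E.
      exact: le_trans (completion_cons_ge (@Nnd w) (@Nrc w) c0 cs0' r0) rC.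
    case: cs cs0' rC rcC {st H good pc Scs hcs} => [|c2 cs2] cs0' rC rcC.
      by apply: le_trans rcC; rewrite /= lee_fin lerD2r.
    have E : s + c + (p + h - c) = s + p + h by ring.
    rewrite /covers E.
    have [rc|rc] := leP (r + c) (s + p + h).
      exists (r + c); split => //; first by rewrite lerD2r.
      rewrite -Nr; apply: (@sandwich _ _ _ (s + p + h)) => //.
      by rewrite lerDl.
    (* The current task in truth ends after this cell; letting the next one start at the end of the
       cell only makes it earlier. *)
    exists (s + p + h); split => //.
      by rewrite -addrA lerD2l.
    apply: le_trans rcC.
    apply: (le_completion (@Nnd w) (@Nrc w)) => //; last exact: ltW.
    by apply: le_trans sph.
move: hcs Scs => /= /andP[hc hcs]; rewrite big_cons => Scs.
apply: IH => //.
- by move=> c' cs' e; move: hcs; rewrite e /= => /andP[].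
- by apply: le_trans Scs; rewrite lerDr.
- move=> w; rewrite patternS => -[/H[r [sr rsp Nr rC]]] _.
  have r0 : 0 <= r by exact: le_trans sr.
  have rcC : (C w (r + c) cs <= C w 0 cs0)%E.
    exact: le_trans (completion_cons_ge (@Nnd w) (@Nrc w) c0 cs0' r0) rC.
  have sprc : s + p <= r + c by apply: lerD => //; exact: ltW.
  case: cs cs0' rC rcC hcs {st H good pc Scs} => [|c2 cs2] cs0' rC rcC hcs.
    by apply: le_trans rcC; rewrite /= lee_fin.
  have [r' [spr' r'sph Nr' r'P]] := last w.
  exists r'; split => //; apply: le_trans rcC.
  (* The next task is first advanced to start at [s + p], then restarted at the disruption [r'],
     which falls within its first [h] units. *)
  apply: (@le_trans _ _ (C w (s + p) (c2 :: cs2))); last first.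
    exact: (le_completion (@Nnd w) (@Nrc w)).
  case: r'P => [->//|[_ jr']].
  move: hcs cs0' => /= /andP[/ltW hc2 _] /andP[c20 cs20].
  apply: (completion_restart (@Nnd w) (@Nrc w)) => //.
  by apply: (le_trans r'sph); rewrite lerD2l.
Qed.

End Lower.
End Recursion.

(** * Truncation at the horizon and the expected makespan *)

Section Makespan.
Context d (T : measurableType d) (R : realType) (P : probability T R).
Context (lam : R -> R) (N : T -> R -> nat).
Hypothesis NP : is_nhpp P lam N.
Variable B : R.
Hypothesis lam0 : forall x, 0 < x -> 0 <= lam x.
Hypothesis lamB : forall x, 0 < x -> lam x <= B.
Variable cs : seq R.
Hypothesis cs0 : all (fun c => 0 <= c) cs.

Let S : R := \sum_(c <- cs) c.
Let S0 : 0 <= S. Proof. by rewrite /S big_seq; apply: sumr_ge0 => x /(allP cs0). Qed.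

Local Notation C w := (completion (N w) 0 cs).

Let Nnd w s s' : 0 <= s -> s <= s' -> (N w s <= N w s')%N.
Proof. by case: NP => _ nd _ _ _; exact: nd. Qed.

Let Nrc w s : 0 <= s ->
  exists2 e : R, 0 < e & forall u, s <= u -> u < s + e -> N w u = N w s.
Proof. by case: NP => _ _ rc _ _; exact: rc. Qed.

Let C0 w : (0 <= C w)%E.
Proof. exact: (completion_ge (@Nnd w) (@Nrc w) cs0). Qed.

(** The same patterns, now with the batch length [S] as mesh: each of the first [k] blocks is
    disrupted. *)
Let bad (k : nat) : set T := pattern N S (nseq k false).

Let mbad k : measurable (bad k). Proof. exact: (measurable_pattern NP S0). Qed.

Let badS k : bad k.+1 = bad k `&` ~` cell_clear N S k.
Proof. by rewrite /bad -addn1 nseqD cats1 patternS size_nseq. Qed.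

Let bad_le k l : (k <= l)%N -> bad l `<=` bad k.
Proof.
move=> /subnK <-; elim: (l - k)%N => [//|m IH].
by rewrite addSn badS => w [/IH].
Qed.

Lemma cell_prob_false_le (h : R) k : 0 <= h -> cell_prob lam h k false <= B * h.
Proof.
move=> h0; rewrite /cell_prob.
have := @mean_meas_bounds _ lam (k%:R * h) (k.+1%:R * h) 0 B.
have -> : k.+1%:R * h - k%:R * h = h by rewrite -mulrBl -natrB// subSnn mul1r.
move=> /(_ _ (lexx _) _)/andP[].
- by rewrite ler_wpM2r// ler_nat.
- move=> x kx _; have x0 : 0 < x by apply: le_lt_trans kx; rewrite mulr_ge0.
  by rewrite lam0//= lamB.
- rewrite -/(cell_mean lam h k) => _ mB; apply: le_trans mB.
  by rewrite lerBlDl -lerBlDr; apply: le_trans (expR_ge1Dx _); rewrite addrC.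
Qed.

Lemma prob_bad_le k : (P (bad k) <= ((B * S) ^+ k)%:E)%E.
Proof.
elim: k => [|k IH]; first by rewrite expr0 probability_le1.
rewrite /bad -addn1 nseqD cats1 (prob_patternS NP S0 lam0 lamB) size_nseq.
rewrite exprD expr1 EFinM.
apply: lee_pmul => //.
- rewrite lee_fin /cell_prob subr_ge0 -expR0 ler_expR oppr_le0.
  exact: (cell_mean_ge0 S0 lam0 lamB).
- by rewrite lee_fin; exact: cell_prob_false_le.
Qed.

(** A clear block among the first [k] completes the batch by its end. *)
Let not_badP k w : ~ bad k w -> (C w <= (k%:R * S)%:E)%E.
Proof.
elim: k => [|k IH] nb; first by case: nb => i.
have [bk|/IH Ck] := pselect (bad k w); last first.
  by apply: (le_trans Ck); rewrite lee_fin ler_wpM2r// ler_nat.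
have ck : cell_clear N S k w by apply: contrapT => nc; apply: nb; rewrite badS.
have kS : k.+1%:R * S = k%:R * S + S by rewrite -natr1 mulrDl mul1r.
rewrite kS; apply: (completion_le_clear_block (@Nnd w) (@Nrc w) cs0).
  by rewrite mulr_ge0.
by rewrite -/S -kS.
Qed.

(** Summed over [k], this charges [S] for every further block that may be needed after [4 * S]. *)
Let tail (k : nat) (w : T) : R := S * \1_(bad (k + 4)) w.

Let tail_ge0 k w : 0 <= tail k w. Proof. by rewrite mulr_ge0. Qed.

Hypothesis S_gt0 : 0 < S.

Let partial_tail w n : bad (n + 4) w ->
  ((n.+1%:R * S)%:E <= \sum_(k <oo) (tail k w)%:E)%E.
Proof.
move=> bn.
have t0 k : (0 <= k)%N -> true -> (0 <= (tail k w)%:E)%E by rewrite lee_fin.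
apply: le_trans (nneseries_lim_ge n.+1 t0).
rewrite big_mkord (eq_bigr (fun=> S%:E)); last first.
  move=> i _; rewrite /tail indicE mem_set ?mulr1//.
  by apply: bad_le bn; rewrite leq_add2r -ltnS.
by rewrite sumEFin sumr_const card_ord mulr_natl.
Qed.

(** Let [m] be least with [bad m] false, so that the batch ends by [m * S]. If [m > 4], then
    [bad (m - 1)] holds and [m - 4] summands of the tail equal [S]. If there is no such [m], the
    tail sum is infinite. *)
Lemma completion_le_tail w :
  (C w <= (4 * S)%:E \/ C w <= (4 * S)%:E + \sum_(k <oo) (tail k w)%:E)%E.
Proof.
have [[n nb]|ab] := pselect (exists n, `[< ~ bad n w >]); last first.
  right; rewrite (_ : \sum_(k <oo) (tail k w)%:E = +oo)%E ?addey ?leey//.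
  apply/eqyP => A A0; pose n := Num.trunc (A / S).
  apply: (@le_trans _ _ (n.+1%:R * S)%:E).
    by rewrite lee_fin -ler_pdivrMr// ltW// truncnS_gt.
  apply: partial_tail; apply: contrapT => nb; apply: ab.
  by exists (n + 4)%N; apply/asboolP.
have exn : exists n, `[< ~ bad n w >] by exists n.
case: (ex_minnP exn) => m /asboolP mb mmin.
have := not_badP mb.
have [m4 Cm|m4 Cm] := leqP m 4.
  by left; apply: (le_trans Cm); rewrite lee_fin ler_wpM2r// ler_nat.
right; apply: (le_trans Cm).
have bm : bad (m - 5 + 4) w.
  apply: contrapT => /asboolP/mmin; rewrite leqNgt => /negP; apply.
  by lia.
apply: le_trans (leeD (le_refl _) (partial_tail bm)).
rewrite -EFinD lee_fin -mulrDl ler_wpM2r//.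
by rewrite -natrD ler_nat; lia.
Qed.

Let geometric_le (z : R) n : 0 <= z -> z <= 1 / 2 -> \sum_(k < n) z ^+ k <= 2 - 2 * z ^+ n.
Proof.
move=> z0 z2; elim: n => [|n IH]; first by rewrite big_ord0 expr0; lra.
rewrite big_ord_recr/= exprS; have := exprn_ge0 n z0.
move: IH; set x := z ^+ n => IH x0; have : z * x <= 1 / 2 * x by rewrite ler_wpM2r.
lra.
Qed.

Hypothesis BS : B * S <= 1 / 2.
Hypothesis B0 : 0 <= B.

Let BS0 : 0 <= B * S. Proof. by rewrite mulr_ge0. Qed.

Let mtail k : measurable_fun setT (tail k).
Proof. by apply: measurable_funM => //; exact: measurable_indic. Qed.

(** A geometric series of ratio [B * S <= 1 / 2]; the result is of fifth order in [S], hence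
    negligible against the order of the comparison. *)
Lemma integral_tail : (\int[P]_w \sum_(k <oo) (tail k w)%:E <=
  (2 * S * (B * S) ^+ 4)%:E)%E.
Proof.
rewrite integral_nneseries//; last 2 first.
- by move=> k; exact/measurable_EFinP.
- by move=> k w _; rewrite lee_fin.
apply: lime_le.
  by apply: is_cvg_nneseries => k _ _; apply: integral_ge0 => w _; rewrite lee_fin.
apply: nearW => n; rewrite big_mkord.
apply: (@le_trans _ _ (\sum_(k < n) (S * (B * S) ^+ (k + 4))%:E)%E).
  apply: lee_sum => k _.
  rewrite (integralZl_indic measurableT (fun=> bad (k + 4)))//; last first.
    by rewrite ltNge S0.
  rewrite integral_indic// setIT [leRHS]EFinM lee_wpmul2l//.
  exact: prob_bad_le.
rewrite sumEFin lee_fin.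
rewrite (eq_bigr (fun k : 'I_n => S * (B * S) ^+ 4 * (B * S) ^+ k)); last first.
  by move=> k _; rewrite exprD; ring.
rewrite -mulr_sumr (_ : 2 * S * (B * S) ^+ 4 = S * (B * S) ^+ 4 * 2); last by ring.
apply: ler_wpM2l; first by rewrite mulr_ge0// exprn_ge0.
apply: le_trans (geometric_le n BS0 BS) _.
by rewrite gerBl mulr_ge0// exprn_ge0.
Qed.

Section Grid.
Variables (h : R) (m : nat) (U : R -> R -> seq R -> R).
Hypothesis h_gt0 : 0 < h.
Hypothesis mh : (4 * m)%:R * h = 4 * S.
Hypothesis hcs : all (fun c => h < c) cs.

Let L : R := (4 * m)%:R * h.

Let pat_nil : pattern N h [::] = setT.
Proof. by rewrite -subTset => w _ i. Qed.

(** Pathwise, the completion time is at most its truncation at [4 * S], which the recursion bounds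
    from the empty pattern, plus the tail sum. *)
Lemma makespan_le :
  (forall s p, 0 <= s -> s + p <= L -> s <= U s p [::]) ->
  (forall s p c cs', state_ok h S s p c cs' -> s + p = L -> L <= U s p (c :: cs')) ->
  (forall k s p c cs', (k < 4 * m)%N -> s + p = k%:R * h ->
    state_ok h S s p c cs' -> p + h < c ->
    cell_prob lam h k true * U s (p + h) (c :: cs') +
    cell_prob lam h k false * U (s + p + h) 0 (c :: cs') <= U s p (c :: cs')) ->
  (forall k s p c cs', (k < 4 * m)%N -> s + p = k%:R * h ->
    state_ok h S s p c cs' -> c <= p + h ->
    cell_prob lam h k true * U (s + c) (p + h - c) cs' +
    cell_prob lam h k false * U (s + p + h) 0 (c :: cs') <= U s p (c :: cs')) ->
  (\int[P]_w C w <= (U 0 0 cs + 2 * S * (B * S) ^+ 4)%:E)%E.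
Proof.
move=> U_nil U_end U_run U_cross.
have := @upper_recursion _ _ _ _ _ _ NP _ h_gt0 lam0 _ lamB cs S (4 * m) U
  U_nil U_end U_run U_cross (4 * m) [::] 0 0 cs erefl.
rewrite addr0 mul0r => -[]//.
  by move=> c cs' e; move: hcs; rewrite e => /andP[+ _]; exact: lt_trans.
move=> g [mg g0 Cg]; rewrite pat_nil probability_setT mul1e => Ig.
rewrite EFinD; apply: le_trans (leeD Ig integral_tail).
have mEg : measurable_fun setT (EFin \o g) by exact/measurable_EFinP.
have mt : measurable_fun setT (fun w => \sum_(k <oo) (tail k w)%:E)%E.
  apply: (@ge0_emeasurable_sum _ _ _ _ _ xpredT) => [k w _ _|k _].
    by rewrite lee_fin.
  exact/measurable_EFinP.
have t0 w : (0 <= \sum_(k <oo) (tail k w)%:E)%E.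
  by apply: nneseries_ge0 => k _ _; rewrite lee_fin.
rewrite -ge0_integralD//; last by move=> w _; rewrite lee_fin.
apply: ge0_le_integral_nomeas => [w _|w _]; first exact: C0.
have := Cg w; rewrite pat_nil => /(_ I).
rewrite mh; case: (leP (C w) (4 * S)%:E) => [CL Cgw|LC].
  by apply: (le_trans Cgw); rewrite leeDl.
move=> Lg; case: (completion_le_tail w); first by rewrite leNgt LC.
by move=> /le_trans; apply; exact: leeD.
Qed.

(** Paths unfinished at [L] belong to [bad 4]. Adding the bonus [2 * S] there yields an [X] fit for
    the recursion, and the expected bonus is subtracted again. *)
Lemma makespan_ge :
  (forall s p, 0 <= s -> s + p <= L -> U s p [::] <= s) ->
  (forall s p c cs', state_ok h S s p c cs' -> s + p = L ->
    U s p (c :: cs') <= L + 2 * S) ->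
  (forall k s p c cs', (k < 4 * m)%N -> s + p = k%:R * h ->
    state_ok h S s p c cs' -> p + h < c ->
    U s p (c :: cs') <=
    cell_prob lam h k true * U s (p + h) (c :: cs') +
    cell_prob lam h k false * U (s + p) h (c :: cs')) ->
  (forall k s p c cs', (k < 4 * m)%N -> s + p = k%:R * h ->
    state_ok h S s p c cs' -> c <= p + h ->
    U s p (c :: cs') <=
    cell_prob lam h k true * U (s + c) (p + h - c) cs' +
    cell_prob lam h k false * U (s + p) h cs') ->
  ((U 0 0 cs - 2 * S * (B * S) ^+ 4)%:E <= \int[P]_w C w)%E.
Proof.
move=> U_nil U_end U_run U_cross.
pose u w : R := 2 * S * \1_(bad 4) w.
have S2 : 0 <= 2 * S by rewrite mulr_ge0.
have u0 w : 0 <= u w by rewrite mulr_ge0.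
pose X w := (C w + (u w)%:E)%E.
have := @lower_recursion _ _ _ _ _ _ NP _ h_gt0 lam0 _ lamB cs S (4 * m) U X (2 * S)
  S2 _ _ U_nil U_end U_run U_cross (4 * m) [::] 0 0 cs erefl.
rewrite addr0 mul0r => -[]//.
- by move=> w; rewrite /X leeDl// lee_fin.
- move=> w LC; rewrite /X /u indicE mem_set ?mulr1 ?EFinD ?leeD2r ?ltW//.
  apply: contrapT => /not_badP; rewrite leNgt => /negP; apply.
  by rewrite -mh.
- by move=> c cs' e; move: hcs; rewrite e => /andP[+ _]; exact: lt_trans.
- by move=> w _; have := C0 w; case: cs => [//|c cs'] _; exists 0.
move=> g [mg g0 _ gX]; rewrite pat_nil probability_setT mul1e => Ig.
have mu : measurable_fun setT u.
  by apply: measurable_funM => //; exact: measurable_indic.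
have Iu : (\int[P]_w (u w)%:E <= (2 * S * (B * S) ^+ 4)%:E)%E.
  rewrite (integralZl_indic measurableT (fun=> bad 4))//; last by rewrite ltNge S2.
  by rewrite integral_indic// setIT [leRHS]EFinM lee_wpmul2l// prob_bad_le.
(* Cutting at 0 keeps the minorant of the completion time nonnegative, and [g <= v + u] survives. *)
pose v w := Num.max (g w - u w) 0.
have mv : measurable_fun setT v.
  by apply: measurable_maxr => //; exact: measurable_funB.
have v0 w : 0 <= v w by rewrite le_max lexx orbT.
have vC : (\int[P]_w (v w)%:E <= \int[P]_w C w)%E.
  apply: ge0_le_integral_nomeas => w _; first by rewrite lee_fin.
  rewrite /v EFin_max ge_max C0 andbT EFinB leeBlDr//.
  by have := gX w; rewrite pat_nil => /(_ I).
rewrite EFinB leeBlDr//; apply: (le_trans Ig).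
apply: le_trans (leeD vC Iu).
have mEv : measurable_fun setT (EFin \o v) by exact/measurable_EFinP.
have mEu : measurable_fun setT (EFin \o u) by exact/measurable_EFinP.
rewrite -ge0_integralD//=; last 2 first.
- by move=> w _; rewrite lee_fin.
- by move=> w _; rewrite lee_fin.
apply: ge0_le_integral_nomeas => w _; first by rewrite lee_fin.
by rewrite -EFinD lee_fin -lerBlDr le_max lexx.
Qed.

End Grid.

End Makespan.

(** * The third-order expansion and its one-step residual *)

Section Expansion.
Context {R : realType} (a d : R).

(* [s + c + stepcost s c] is the expected completion time, up to third order, of a
   task of length [c] started at [s] under the intensity [a + d t]. *)
Definition stepcost (s c : R) : R :=
  a * c ^+ 2 / 2 + a ^+ 2 * c ^+ 3 / 6 + d * (s * c ^+ 2 / 2 + c ^+ 3 / 3).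

Fixpoint psi (s : R) (cs : seq R) : R :=
  if cs is c :: cs' then stepcost s c + psi (s + c) cs' else s.

(** Progress [p] lowers the expected completion time by [stepcost s p], the cost of the risk already
    survived. Once no task is left, the time [s] stays frozen whatever [p] is. *)
Definition psi_at (s p : R) (cs : seq R) : R :=
  if cs is _ :: _ then psi s cs - stepcost s p else s.

Lemma stepcost0 s : stepcost s 0 = 0.
Proof. by rewrite /stepcost; field. Qed.

(** A delay [x] raises the affine intensity by [d * x], which costs each task [d * x * c ^+ 2 / 2];
    this is exact because [stepcost] is affine in [s]. *)
Lemma psi_shift s x cs :
  psi (s + x) cs = psi s cs + x + d * x * (\sum_(c <- cs) c ^+ 2) / 2.
Proof.
elim: cs s => [|c cs IH] s /=; first by rewrite big_nil; ring.
by rewrite big_cons (addrAC s x c) IH /stepcost; field.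
Qed.

Lemma sum_sqr_le (cs : seq R) S : all (fun c => 0 <= c) cs ->
  \sum_(c <- cs) c <= S -> 0 <= \sum_(c <- cs) c ^+ 2 <= S ^+ 2.
Proof.
move=> cs0 csS; apply/andP; split; first by apply: sumr_ge0 => c _; exact: sqr_ge0.
suff [s0 h] : 0 <= \sum_(c <- cs) c /\
    \sum_(c <- cs) c ^+ 2 <= (\sum_(c <- cs) c) ^+ 2.
  by apply: (le_trans h); rewrite lerXn2r ?nnegrE// (le_trans s0).
elim: cs cs0 {csS} => [|c cs IH] /=; first by rewrite !big_nil expr0n.
move=> /andP[c0 /IH[s0 h]]; rewrite !big_cons; split; first exact: addr_ge0.
rewrite sqrrD; have : 0 <= c * (\sum_(j <- cs) j) by rewrite mulr_ge0.
move: h; lra.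
Qed.

Lemma normM_ge0_le (x m M : R) : 0 <= m -> m <= M -> `|x * m| <= `|x| * M.
Proof. by move=> m0 mM; rewrite normrM (ger0_norm m0) ler_wpM2l. Qed.

(** [Kz] bounds the cubic remainder [Z] in [one_step_residual], [Kl * S] is the Lipschitz constant
    of [stepcost s], and [Ke] adds up the constants of the three residual terms. *)
Definition Kz : R := 110 * `|d| + 21 * `|a| ^+ 2.
Definition Kl : R := 5 * `|a| + 13 * `|a| ^+ 2 + 50 * `|d|.
Definition Ke : R := `|a| * Kz + 10 * `|d| * (13 * `|a| + Kz)
  + (`|a| + 3 * `|a| ^+ 2 + 8 * `|d|) + (5 + 13 * `|a| + Kz).

Lemma Kz_ge0 : 0 <= Kz. Proof. by rewrite addr_ge0// mulr_ge0// exprn_ge0. Qed.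
Lemma Kl_ge0 : 0 <= Kl. Proof. by rewrite !addr_ge0// mulr_ge0// exprn_ge0. Qed.
Lemma Ke_ge0 : 0 <= Ke.
Proof.
by rewrite !addr_ge0 ?Kz_ge0 ?mulr_ge0 ?exprn_ge0 ?addr_ge0 ?Kz_ge0 ?mulr_ge0.
Qed.

Lemma stepcost_lipschitz S s x y : 0 < S -> S <= 1 -> 0 <= s -> s <= 5 * S ->
  0 <= x -> x <= 5 * S -> 0 <= y -> y <= 5 * S ->
  `|stepcost s x - stepcost s y| <= Kl * S * `|x - y|.
Proof.
move=> S0 S1 s0 sS x0 xS y0 yS.
pose u := x + y; pose v := x ^+ 2 + x * y + y ^+ 2.
have SS : S ^+ 2 <= S by rewrite expr2 ler_piMl// ltW.
have mul5 p q : 0 <= p -> p <= 5 * S -> 0 <= q -> q <= 5 * S ->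
    0 <= p * q /\ p * q <= 25 * S.
  move=> p0 pS q0 qS; split; first exact: mulr_ge0.
  apply: (@le_trans _ _ ((5 * S) * (5 * S))); first exact: ler_pM.
  by move: SS; rewrite expr2; lra.
have [xx0 xx] := mul5 _ _ x0 xS x0 xS; have [xy0 xy] := mul5 _ _ x0 xS y0 yS.
have [yy0 yy] := mul5 _ _ y0 yS y0 yS; have [sx0 sx] := mul5 _ _ s0 sS x0 xS.
have [sy0 sy] := mul5 _ _ s0 sS y0 yS.
have -> : stepcost s x - stepcost s y = (a * (u / 2) + a ^+ 2 * (v / 6)
    + d * (s * u / 2 + v / 3)) * (x - y).
  by rewrite /stepcost /u /v; field.
rewrite normrM ler_wpM2r//.
have u2 : 0 <= u / 2 /\ u / 2 <= 5 * S by rewrite /u; lra.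
have v6 : 0 <= v / 6 /\ v / 6 <= 13 * S by rewrite /v !expr2; lra.
have w3 : 0 <= s * u / 2 + v / 3 /\ s * u / 2 + v / 3 <= 50 * S.
  by rewrite /u /v !expr2 mulrDr; lra.
apply: (le_trans (ler_normD _ _)).
have := normM_ge0_le d w3.1 w3.2; have := normM_ge0_le (a ^+ 2) v6.1 v6.2.
have := normM_ge0_le a u2.1 u2.2.
have := ler_normD (a * (u / 2)) (a ^+ 2 * (v / 6)).
rewrite normrX /Kl; lra.
Qed.

(** The quantity bounded is the expected change of [psi_at] over a cell in which no task ends, a
    disruption leading to start [s + p + h] without progress. The derivative of [stepcost s] cancels
    the leading part of [q] times the loss; cubic terms, the error of [q] and mesh terms remain. *)
Lemma one_step_residual S h s p q S2 e : 0 < S -> S <= 1 -> 0 <= h -> h <= S ->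
  0 <= s -> s <= 5 * S -> 0 <= p -> p + h <= 5 * S -> 0 <= S2 -> S2 <= S ^+ 2 ->
  `|q - h * (a + d * (s + p + h))| <= h * e ->
  `|stepcost s p - stepcost s (p + h)
    + q * (p + h + d * (p + h) * S2 / 2 + stepcost s (p + h))|
  <= h * (Ke * (S ^+ 3 + e * S + h)).
Proof.
move=> S0 S1 h0 hS s0 sS p0; set r := p + h => rS S20 S2S qe.
have r0 : 0 <= r by rewrite addr_ge0.
have rn n : 0 <= r ^+ n /\ r ^+ n <= 5 ^+ n * S ^+ n.
  by split; [exact: exprn_ge0|rewrite -exprMn lerXn2r// nnegrE mulr_ge0// ltW].
have S20' := exprn_ge0 2 (ltW S0).
have S30' := exprn_ge0 3 (ltW S0).
have SS2 : S ^+ 2 <= S by rewrite expr2 ler_piMl// ltW.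
have SS3 : S ^+ 3 <= S ^+ 2 by rewrite exprS ler_piMl.
have rS2 : 0 <= r * S2 /\ r * S2 <= 5 * S ^+ 3.
  split; first exact: mulr_ge0.
  by rewrite [_ ^+ 3]exprS mulrA ler_pM.
have sr2 : 0 <= s * r ^+ 2 /\ s * r ^+ 2 <= 125 * S ^+ 3.
  split; first by rewrite mulr_ge0// (rn 2).1.
  apply: (@le_trans _ _ ((5 * S) * (5 ^+ 2 * S ^+ 2))).
    by rewrite ler_pM// ?(rn 2).1 ?(rn 2).2.
  by rewrite le_eqVlt; apply/orP; left; apply/eqP; ring.
have r3 := rn 3; have r2 := rn 2.
pose m := r * S2 / 2 + s * r ^+ 2 / 2 + r ^+ 3 / 3.
(* The loss [X] caused by a disruption is [r + a * r ^+ 2 / 2] up to the cubic remainder [Z]. *)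
pose Z := d * m + a ^+ 2 * (r ^+ 3 / 6).
pose X := r + d * r * S2 / 2 + stepcost s r.
have m0 : 0 <= m /\ m <= 110 * S ^+ 3 by rewrite /m; lra.
have r36 : 0 <= r ^+ 3 / 6 /\ r ^+ 3 / 6 <= 21 * S ^+ 3 by lra.
have r22 : 0 <= r ^+ 2 / 2 /\ r ^+ 2 / 2 <= 13 * S ^+ 2 by lra.
have XE : X = r + a * (r ^+ 2 / 2) + Z by rewrite /X /Z /m /stepcost; field.
have Kz0 := Kz_ge0.
have ZS : `|Z| <= Kz * S ^+ 3.
  apply: (le_trans (ler_normD _ _)).
  have := normM_ge0_le d m0.1 m0.2; have := normM_ge0_le (a ^+ 2) r36.1 r36.2.
  by rewrite normrX /Kz; lra.
have XrS : `|X - r| <= (13 * `|a| + Kz) * S ^+ 2.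
  have -> : X - r = a * (r ^+ 2 / 2) + Z by rewrite XE; ring.
  apply: (le_trans (ler_normD _ _)).
  have := normM_ge0_le a r22.1 r22.2.
  have : Kz * S ^+ 3 <= Kz * S ^+ 2 by rewrite ler_wpM2l.
  by move: ZS; lra.
have KX0 : 0 <= 13 * `|a| + Kz by rewrite addr_ge0// mulr_ge0.
have XS : `|X| <= (5 + 13 * `|a| + Kz) * S.
  have -> : X = r + (X - r) by ring.
  apply: (le_trans (ler_normD _ _)).
  have : (13 * `|a| + Kz) * S ^+ 2 <= (13 * `|a| + Kz) * S by rewrite ler_wpM2l.
  by move: XrS; rewrite (ger0_norm r0); lra.
(* [h * h * G] is the Taylor remainder of [stepcost s] from [r] to [r - h]. *)
pose G := a * (1 / 2) + a ^+ 2 * (r / 2 - h / 6) + d * (s / 2 + r - h / 3).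
have GS : `|G| <= `|a| + 3 * `|a| ^+ 2 + 8 * `|d|.
  have hr : h <= r by rewrite /r lerDr.
  have g1 : 0 <= r / 2 - h / 6 /\ r / 2 - h / 6 <= 3 by lra.
  have g2 : 0 <= s / 2 + r - h / 3 /\ s / 2 + r - h / 3 <= 8 by lra.
  have g3 : 0 <= (1 / 2 : R) /\ (1 / 2 : R) <= 1 by lra.
  have := normM_ge0_le a g3.1 g3.2; have := normM_ge0_le (a ^+ 2) g1.1 g1.2.
  have := normM_ge0_le d g2.1 g2.2.
  have := ler_normD (a * (1 / 2) + a ^+ 2 * (r / 2 - h / 6)) (d * (s / 2 + r - h / 3)).
  have := ler_normD (a * (1 / 2)) (a ^+ 2 * (r / 2 - h / 6)).
  by rewrite /G !normrX; lra.
have TS : `|a * Z + d * (s + r) * (X - r)| <=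
    (`|a| * Kz + 10 * `|d| * (13 * `|a| + Kz)) * S ^+ 3.
  apply: (le_trans (ler_normD _ _)); rewrite !normrM.
  have : `|a| * `|Z| <= `|a| * (Kz * S ^+ 3) by rewrite ler_wpM2l.
  have sr : `|s + r| <= 10 * S by rewrite ger0_norm ?addr_ge0//; lra.
  have : `|d| * `|s + r| * `|X - r| <= `|d| * (10 * S) * ((13 * `|a| + Kz) * S ^+ 2).
    by rewrite ler_pM ?mulr_ge0// ler_wpM2l.
  rewrite [S ^+ 3]exprS; lra.
have -> : stepcost s p - stepcost s r + q * (r + d * r * S2 / 2 + stepcost s r) =
    h * (a * Z + d * (s + r) * (X - r)) + h * h * G
    + (q - h * (a + d * (s + p + h))) * X.
  have pE : p = r - h by rewrite /r; ring.
  have ZE : Z = X - r - a * (r ^+ 2 / 2) by rewrite XE; ring.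
  by rewrite ZE /G -/X /stepcost pE; field.
apply: (le_trans (ler_normD _ _)).
have t1 : `|h * (a * Z + d * (s + r) * (X - r))| <=
   h * ((`|a| * Kz + 10 * `|d| * (13 * `|a| + Kz)) * S ^+ 3).
  by rewrite normrM (ger0_norm h0) ler_wpM2l.
have t2 : `|h * h * G| <= h * (h * (`|a| + 3 * `|a| ^+ 2 + 8 * `|d|)).
  by rewrite !normrM (ger0_norm h0) -mulrA !ler_wpM2l.
have t3 : `|(q - h * (a + d * (s + p + h))) * X| <=
    h * e * ((5 + 13 * `|a| + Kz) * S).
  by rewrite normrM ler_pM.
have := ler_normD (h * (a * Z + d * (s + r) * (X - r))) (h * h * G).
have he0 : 0 <= h * e by exact: le_trans qe.
set K1 := `|a| * Kz + 10 * `|d| * (13 * `|a| + Kz) in t1 *.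
set K2 := `|a| + 3 * `|a| ^+ 2 + 8 * `|d| in t2 *.
set K3 := 5 + 13 * `|a| + Kz in t3 *.
have K10 : 0 <= K1 by rewrite addr_ge0 ?mulr_ge0.
have K20 : 0 <= K2 by rewrite !addr_ge0 ?mulr_ge0 ?exprn_ge0.
have K30 : 0 <= K3 by rewrite !addr_ge0 ?mulr_ge0.
have KeE : Ke = K1 + K2 + K3 by [].
have p1 : 0 <= (K2 + K3) * (h * S ^+ 3).
  by apply: mulr_ge0; [exact: addr_ge0|exact: mulr_ge0].
have p2 : 0 <= (K1 + K3) * (h * h).
  by apply: mulr_ge0; [exact: addr_ge0|exact: mulr_ge0].
have p3 : 0 <= (K1 + K2) * (h * e * S).
  by apply: mulr_ge0; [exact: addr_ge0|exact: mulr_ge0 he0 (ltW S0)].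
rewrite KeE; move: t1 t2 t3 p1 p2 p3; lra.
Qed.

End Expansion.

(** The cell mean [m] differs from [h] times the affine intensity at the right end of the cell by
    the linearisation error and the variation inside the cell; [1 - expR (- m)] differs from [m] by
    at most [m ^+ 2]. *)
Lemma cell_prob_approx (R : realType) (lam : R -> R) (a d B dl S h : R) (k : nat) :
  0 < h -> (forall x, 0 < x -> 0 <= lam x) -> (forall x, 0 < x -> lam x <= B) ->
  0 <= dl -> k%:R * h + h <= 4 * S ->
  (forall u, 0 < u -> u <= 4 * S -> `|lam u - a - d * u| <= dl * u) ->
  `|cell_prob lam h k false - h * (a + d * (k%:R * h + h))|
  <= h * (4 * dl * S + (`|d| + B ^+ 2) * h).
Proof.
move=> h0 lam0 lamB dl0 khS lamE.
set t := k%:R * h; set A := a + d * (t + h); pose e1 := 4 * dl * S + `|d| * h.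
have t0 : 0 <= t by rewrite mulr_ge0// ltW.
have tS : k.+1%:R * h = t + h by rewrite -natr1 mulrDl mul1r.
pose m := cell_mean lam h k.
have m0 : 0 <= m by exact: (cell_mean_ge0 (ltW h0) lam0 lamB).
have lamA x : t < x -> x <= t + h -> A - e1 <= lam x <= A + e1.
  move=> tx xth.
  have x0 : 0 < x by exact: le_lt_trans tx.
  have := lamE x x0 (le_trans xth khS).
  have : `|d * (x - (t + h))| <= `|d| * h.
    by rewrite normrM ler_wpM2l// ler_norml; lra.
  have : dl * x <= dl * (4 * S) by rewrite ler_wpM2l// (le_trans xth).
  rewrite !ler_norml => dx /andP[l1 l2] /andP[l3 l4].
  by rewrite /A /e1; lra.
have th : t <= t + h by rewrite lerDl ltW.
have hE : t + h - t = h by ring.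
have mB : m <= B * h.
  have := @mean_meas_bounds _ lam t (t + h) 0 B th (lexx _).
  rewrite hE /m /cell_mean -/t tS => H.
  suff lam_itv x : t < x -> x <= t + h -> 0 <= lam x <= B by have /andP[] := H lam_itv.
  by move=> tx _; have x0 := le_lt_trans t0 tx; rewrite lam0//= lamB.
have mA : `|m - h * A| <= h * e1.
  have mhi : m <= (A + e1) * h.
    have := @mean_meas_bounds _ lam t (t + h) 0 (A + e1) th (lexx _).
    rewrite hE /m /cell_mean -/t tS => H.
    suff lam_itv x : t < x -> x <= t + h -> 0 <= lam x <= A + e1.
      by have /andP[] := H lam_itv.
    move=> tx xt; have x0 := le_lt_trans t0 tx; rewrite lam0//=.
    by have /andP[] := lamA x tx xt.
  have mlo : (A - e1) * h <= m.
    (* [mean_meas_bounds] wants a nonnegative lower constant; a nonpositive one gives a trivial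
       bound. *)
    have [neg|pos] := leP (A - e1) 0.
      by apply: le_trans m0; rewrite mulr_le0_ge0// ltW.
    have := @mean_meas_bounds _ lam t (t + h) (A - e1) (A + e1) th (ltW pos).
    by rewrite hE /m /cell_mean -/t tS => H; have /andP[] := H lamA.
  by rewrite ler_norml; lra.
have q1 : 1 - expR (- m) <= m.
  by rewrite lerBlDl -lerBlDr; apply: le_trans (expR_ge1Dx _); rewrite addrC.
have q2 : m - m ^+ 2 <= 1 - expR (- m).
  have m1 : 0 < 1 + m by lra.
  have : expR (- m) <= (1 + m)^-1.
    by rewrite expRN lef_pV2 ?posrE ?expR_gt0//; exact: expR_ge1Dx.
  have : (1 + m)^-1 <= 1 - m + m ^+ 2.
    rewrite -[leLHS]mul1r ler_pdivrMr//.
    have -> : (1 - m + m ^+ 2) * (1 + m) = 1 + m ^+ 3 by ring.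
    by rewrite lerDl exprn_ge0.
  lra.
have m2 : m ^+ 2 <= B ^+ 2 * h ^+ 2.
  by rewrite -exprMn lerXn2r// nnegrE// (le_trans m0).
rewrite /cell_prob -/m; move: mA; rewrite !ler_norml /e1 => /andP[].
by rewrite expr2 in m2 *; move: q1 q2 m2; rewrite !expr2; lra.
Qed.

(** * One-step inequalities for the corrected expansion *)

Section Analysis.
Context {R : realType} (a d B S h e : R).
Hypothesis B0 : 0 <= B.
Hypothesis S0 : 0 < S.
Hypothesis S1 : S <= 1.
Hypothesis h0 : 0 < h.
Hypothesis hS : h <= S.
Hypothesis dS : `|d| * (15 * S) <= a.
Hypothesis KS : Kl a d * S <= 1.
Hypothesis BS : B * S <= 1 / 2.

(** A completion moves the value by at most [2 * h], a disruption in that cell by at most [4 * h].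
    In [usup_cross] a disruption also brings back one [eta], with weight [q <= 1 / 2], so half of
    [eta] has to cover [6 * h]. *)
Let eta : R := 12 * h.
Let sg : R := Ke a d * (S ^+ 3 + e * S + h) + B * (2 + `|d|) * h.
Hypothesis e0 : 0 <= e.

Let sg0 : 0 <= sg.
Proof.
apply: addr_ge0.
  apply: mulr_ge0; first exact: Ke_ge0.
  by rewrite !addr_ge0 ?exprn_ge0 ?mulr_ge0// ltW.
by rewrite !mulr_ge0 ?addr_ge0// ltW.
Qed.

(* The slack [eta] is paid at each task completion, for its position inside a grid
   cell, and [sg] per unit of time, for the one-step residual. *)
Definition usup (s p : R) (cs : seq R) : R :=
  psi_at a d s p cs + eta * (size cs)%:R + sg * (4 * S - (s + p)).

Definition usub (s p : R) (cs : seq R) : R :=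
  psi_at a d s p cs - eta * (size cs)%:R - sg * (4 * S - (s + p)).

(** The increment is [c - p] times a cofactor that [dS] keeps nonnegative even for [d < 0]: [d * s]
    takes away at most [5 * S] times the norm of [d], the cubic part at most [20 * S / 3] times,
    together less than the [15 * S] times that [a] covers. *)
Lemma le_stepcost s p c : 0 <= s -> s <= 5 * S -> 0 <= p -> p <= c ->
  c <= 5 * S -> stepcost a d s p <= stepcost a d s c.
Proof.
move=> s0 sS p0 pc cS; rewrite -subr_ge0.
have c0 : 0 <= c by exact: le_trans pc.
have -> : stepcost a d s c - stepcost a d s p =
    (c - p) * ((c + p) / 2 * (a + d * s)
      + (c ^+ 2 + c * p + p ^+ 2) * (a ^+ 2 / 6 + d / 3)).
  by rewrite /stepcost; field.
apply: mulr_ge0; first by rewrite subr_ge0.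
set v := c ^+ 2 + c * p + p ^+ 2.
have v0 : 0 <= v by rewrite /v !addr_ge0 ?exprn_ge0// mulr_ge0.
have vle : v <= (c + p) / 2 * (20 * S).
  have : (c + p) * (c + p) <= (c + p) * (10 * S) by rewrite ler_wpM2l ?addr_ge0//; lra.
  have : 0 <= c * p by rewrite mulr_ge0.
  by rewrite /v !expr2; lra.
have dn : - `|d| <= d by rewrite lerNl ler_normr lexx orbT.
have d1 : - (`|d| * (5 * S)) <= d * s.
  have : `|d * s| <= `|d| * (5 * S) by exact: normM_ge0_le.
  by rewrite ler_norml => /andP[].
have t1 : (c + p) / 2 * (a - `|d| * (5 * S)) <= (c + p) / 2 * (a + d * s).
  by apply: ler_wpM2l; lra.
have t2 : v * (- `|d| / 3) <= v * (a ^+ 2 / 6 + d / 3).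
  by apply: ler_wpM2l => //; have := sqr_ge0 a; lra.
have t3 : (c + p) / 2 * (20 * S) * (- `|d| / 3) <= v * (- `|d| / 3).
  by apply: ler_wnM2r => //; have := normr_ge0 d; lra.
have t4 : 0 <= (c + p) / 2 * (a - `|d| * (5 * S) - 20 * S * `|d| / 3).
  apply: mulr_ge0; first lra.
  have : 0 <= `|d| * S by rewrite mulr_ge0// ltW.
  by move: dS; lra.
by move: t1 t2 t3 t4; lra.
Qed.

Lemma stepcost_ge0 s c : 0 <= s -> s <= 5 * S -> 0 <= c -> c <= 5 * S ->
  0 <= stepcost a d s c.
Proof. by move=> *; rewrite -(stepcost0 a d s) le_stepcost. Qed.

Lemma stepcost_close s x y : 0 <= s -> s <= 5 * S ->
  0 <= x -> x <= 5 * S -> 0 <= y -> y <= 5 * S ->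
  `|stepcost a d s x - stepcost a d s y| <= `|x - y|.
Proof.
move=> s0 sS x0 xS y0 yS.
apply: (le_trans (stepcost_lipschitz a d S0 S1 s0 sS x0 xS y0 yS)).
by rewrite ler_piMl.
Qed.

Lemma stepcost_le s c : 0 <= s -> s <= 5 * S -> 0 <= c -> c <= 5 * S ->
  stepcost a d s c <= c.
Proof.
move=> s0 sS c0 cS.
have S5 : 0 <= 5 * S by lra.
have := stepcost_close s0 sS c0 cS (lexx 0) S5.
by rewrite stepcost0 !subr0 (ger0_norm c0) ler_norml => /andP[].
Qed.

(** Each [stepcost] lies between 0 and the length of its task. *)
Lemma psi_bounds s cs : all (fun c => 0 <= c) cs -> 0 <= s ->
  s + \sum_(c <- cs) c <= 5 * S ->
  s + \sum_(c <- cs) c <= psi a d s cs <= s + 2 * \sum_(c <- cs) c.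
Proof.
elim: cs s => [|c cs IH] s /=; first by rewrite big_nil mulr0 addr0 lexx.
move=> /andP[c0 cs0] s0; rewrite big_cons => sS.
have sum0 : 0 <= \sum_(j <- cs) j by rewrite big_seq sumr_ge0// => x /(allP cs0).
have c5 : c <= 5 * S by lra.
have s5 : s <= 5 * S by lra.
have := stepcost_le s0 s5 c0 c5; have := stepcost_ge0 s0 s5 c0 c5.
have sc0 : 0 <= s + c by lra.
have scS : s + c + \sum_(j <- cs) j <= 5 * S by rewrite -addrA.
have /andP[] := IH (s + c) cs0 sc0 scS; lra.
Qed.

Variables (q : R).
Hypothesis q0 : 0 <= q.
Hypothesis qB : q <= B * h.

Let q2 : q <= 1 / 2.
Proof. by apply: (le_trans qB); apply: le_trans BS; rewrite ler_wpM2l. Qed.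

Variables (s p c : R) (cs : seq R).
Hypothesis st : state_ok h S s p c cs.
Hypothesis sp : s + p + h <= 4 * S.

Let s0 : 0 <= s. Proof. by case: st. Qed.
Let p0 : 0 <= p. Proof. by case: st. Qed.
Let pc : p <= c. Proof. by case: st => _ _ /ltW. Qed.
Let c0 : 0 <= c. Proof. exact: le_trans pc. Qed.
Let hcs : all (fun c => h < c) cs. Proof. by case: st => _ _ _ /andP[]. Qed.
Let cs0 : all (fun c => 0 <= c) cs.
Proof. by apply: sub_all hcs => x /ltW; apply: le_trans; exact: ltW. Qed.
Let ccs0 : all (fun c => 0 <= c) (c :: cs). Proof. by rewrite /= c0. Qed.
Let sum0 : 0 <= \sum_(x <- cs) x.
Proof. by rewrite big_seq sumr_ge0// => x /(allP cs0). Qed.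
Let csS : c + \sum_(x <- cs) x <= S.
Proof. by case: st => _ _ _ _; rewrite big_cons. Qed.

(** The values differ by the cost of the missing work [c - p] and of the progress [p + h - c] on the
    next task, each at most [h]. *)
Let good_close : c <= p + h ->
  `|psi_at a d (s + c) (p + h - c) cs - psi_at a d s p (c :: cs)| <= 2 * h.
Proof.
move=> cph.
have [s0_ p0_ pc_ c0_] : [/\ 0 <= s, 0 <= p, p <= c & 0 <= c] by [].
have hc_ : h < c by case: st => _ _ _ /andP[].
have [S0_ h0_ hS_ sp_] : [/\ 0 < S, 0 < h, h <= S & s + p + h <= 4 * S] by [].
have [sum0_ csS_ q2_] : [/\ 0 <= \sum_(x <- cs) x, c + \sum_(x <- cs) x <= S & q <= 1 / 2] by [].

have s5 : s <= 5 * S by lra.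
have c5 : c <= 5 * S by lra.
have p5 : p <= 5 * S by lra.
have sc0 : 0 <= s + c by lra.
have sc5 : s + c <= 5 * S by lra.
have r0 : 0 <= p + h - c by lra.
have r5 : p + h - c <= 5 * S by lra.
have := stepcost_close s0 s5 c0 c5 p0 p5.
have := stepcost_le sc0 sc5 r0 r5; have := stepcost_ge0 sc0 sc5 r0 r5.
rewrite (_ : `|c - p| = c - p); last by rewrite ger0_norm// subr_ge0.
rewrite !ler_norml => l1 l2 /andP[l3 l4].
case: cs => [|c2 cs2] /=; lra.
Qed.

Let good_bounds : c <= p + h -> 0 <= psi_at a d (s + c) (p + h - c) cs <= 7 * S.
Proof.
move=> cph.
have [s0_ p0_ pc_ c0_] : [/\ 0 <= s, 0 <= p, p <= c & 0 <= c] by [].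
have hc_ : h < c by case: st => _ _ _ /andP[].
have [S0_ h0_ hS_ sp_] : [/\ 0 < S, 0 < h, h <= S & s + p + h <= 4 * S] by [].
have [sum0_ csS_ q2_] : [/\ 0 <= \sum_(x <- cs) x, c + \sum_(x <- cs) x <= S & q <= 1 / 2] by [].

have sc0 : 0 <= s + c by lra.
have sc5 : s + c <= 5 * S by lra.
have scS : s + c + \sum_(j <- cs) j <= 5 * S by lra.
have r0 : 0 <= p + h - c by lra.
have r5 : p + h - c <= 5 * S by lra.
have := psi_bounds cs0 sc0 scS.
have := stepcost_le sc0 sc5 r0 r5; have := stepcost_ge0 sc0 sc5 r0 r5.
move: hcs sum0 csS; case: cs => [|c2 cs2] /=; first by move=> *; lra.
rewrite !big_cons => /andP[hc2 _] sum2 csS' l1 l2 /andP[l3 l4].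
by apply/andP; split; lra.
Qed.

(** [B * h * (7 * S)] is at most [7 / 2 * h], by [BS]. *)
Let q_err (x y : R) : 0 <= x <= 7 * S -> 0 <= y <= 7 * S -> `|q * (x - y)| <= 4 * h.
Proof.
move=> /andP[x0 xS] /andP[y0 yS]; rewrite normrM (ger0_norm q0).
apply: (@le_trans _ _ (B * h * (7 * S))).
  by apply: ler_pM => //; rewrite ler_norml; lra.
have : B * S * h <= 1 / 2 * h by rewrite ler_wpM2r// ltW.
by have := h0; lra.
Qed.

Lemma usup_cross : c <= p + h ->
  (1 - q) * usup (s + c) (p + h - c) cs + q * usup (s + p + h) 0 (c :: cs)
  <= usup s p (c :: cs).
Proof.
move=> cph.
have [s0_ p0_ pc_ c0_] : [/\ 0 <= s, 0 <= p, p <= c & 0 <= c] by [].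
have hc_ : h < c by case: st => _ _ _ /andP[].
have [S0_ h0_ hS_ sp_] : [/\ 0 < S, 0 < h, h <= S & s + p + h <= 4 * S] by [].
have [sum0_ csS_ q2_] : [/\ 0 <= \sum_(x <- cs) x, c + \sum_(x <- cs) x <= S & q <= 1 / 2] by [].

have t0 : 0 <= s + p + h by lra.
have tS : s + p + h + \sum_(x <- c :: cs) x <= 5 * S by rewrite big_cons; lra.
have /andP[b1 b2] := psi_bounds ccs0 t0 tS.
have bad : 0 <= psi_at a d (s + p + h) 0 (c :: cs) <= 7 * S.
  rewrite /psi_at stepcost0 subr0; move: b1 b2; rewrite big_cons => b1 b2.
  by apply/andP; split; lra.
have := q_err bad (good_bounds cph); have := good_close cph.
rewrite /usup; set g := psi_at a d (s + c) _ _; set b := psi_at a d (s + p + h) _ _.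
set o := psi_at a d s p _.
rewrite !ler_norml /= => /andP[_ l1] /andP[_ l2].
have E : s + c + (p + h - c) = s + p + h by ring.
rewrite E addr0 -natr1.
have : 0 <= sg * h by rewrite mulr_ge0// ltW.
have : q * eta <= 1 / 2 * eta by rewrite ler_wpM2r// /eta mulr_ge0// ltW.
by rewrite /eta; move: l1 l2; lra.
Qed.

Lemma usub_cross : c <= p + h ->
  usub s p (c :: cs) <=
  (1 - q) * usub (s + c) (p + h - c) cs + q * usub (s + p) h cs.
Proof.
move=> cph.
have [s0_ p0_ pc_ c0_] : [/\ 0 <= s, 0 <= p, p <= c & 0 <= c] by [].
have hc_ : h < c by case: st => _ _ _ /andP[].
have [S0_ h0_ hS_ sp_] : [/\ 0 < S, 0 < h, h <= S & s + p + h <= 4 * S] by [].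
have [sum0_ csS_ q2_] : [/\ 0 <= \sum_(x <- cs) x, c + \sum_(x <- cs) x <= S & q <= 1 / 2] by [].

have t0 : 0 <= s + p by lra.
have tS : s + p + \sum_(x <- cs) x <= 5 * S by lra.
have := psi_bounds cs0 t0 tS.
have sp5 : s + p <= 5 * S by lra.
have h5 : h <= 5 * S by lra.
have := stepcost_le t0 sp5 (ltW h0) h5; have := stepcost_ge0 t0 sp5 (ltW h0) h5.
move=> w1 w2 /andP[b1 b2].
have bad : 0 <= psi_at a d (s + p) h cs <= 7 * S.
  move: b1 b2 hcs cs0 csS; case: cs => [|c2 cs2] /=; first by move=> *; lra.
  rewrite !big_cons => b1 b2 /andP[hc2 _] /andP[_ cs20] csS'.
  have sum2 : 0 <= \sum_(x <- cs2) x by rewrite big_seq sumr_ge0// => x /(allP cs20).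
  by apply/andP; split; lra.
have := q_err bad (good_bounds cph); have := good_close cph.
rewrite /usub; set g := psi_at a d (s + c) _ _; set b := psi_at a d (s + p) _ _.
set o := psi_at a d s p _.
rewrite !ler_norml /= => /andP[l1 _] /andP[l2 _].
have E : s + c + (p + h - c) = s + p + h by ring.
rewrite E -natr1.
have : 0 <= sg * h by rewrite mulr_ge0// ltW.
by rewrite /eta; move: l1 l2; have := h0; lra.
Qed.

Hypothesis qe : `|q - h * (a + d * (s + p + h))| <= h * e.

Let S2 := \sum_(x <- c :: cs) x ^+ 2.

Let residual : p + h < c ->
  `|stepcost a d s p - stepcost a d s (p + h)
    + q * (p + h + d * (p + h) * S2 / 2 + stepcost a d s (p + h))|
  <= h * (Ke a d * (S ^+ 3 + e * S + h)).
Proof.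
move=> phc.
have [s0_ p0_ pc_ c0_] : [/\ 0 <= s, 0 <= p, p <= c & 0 <= c] by [].
have hc_ : h < c by case: st => _ _ _ /andP[].
have [S0_ h0_ hS_ sp_] : [/\ 0 < S, 0 < h, h <= S & s + p + h <= 4 * S] by [].
have [sum0_ csS_ q2_] : [/\ 0 <= \sum_(x <- cs) x, c + \sum_(x <- cs) x <= S & q <= 1 / 2] by [].

have /andP[S20 S2S] : 0 <= S2 <= S ^+ 2.
  by apply: sum_sqr_le => //; rewrite big_cons.
by apply: one_step_residual => //; try exact: ltW; lra.
Qed.

Lemma usup_run : p + h < c ->
  (1 - q) * usup s (p + h) (c :: cs) + q * usup (s + p + h) 0 (c :: cs)
  <= usup s p (c :: cs).
Proof.
move=> phc.
have [s0_ p0_ pc_ c0_] : [/\ 0 <= s, 0 <= p, p <= c & 0 <= c] by [].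
have hc_ : h < c by case: st => _ _ _ /andP[].
have [S0_ h0_ hS_ sp_] : [/\ 0 < S, 0 < h, h <= S & s + p + h <= 4 * S] by [].
have [sum0_ csS_ q2_] : [/\ 0 <= \sum_(x <- cs) x, c + \sum_(x <- cs) x <= S & q <= 1 / 2] by [].
 have := residual phc; rewrite ler_norml => /andP[_ r].
(* [psi_shift] writes the restarted value through [psi] at [s], so that the claim becomes the
   residual bound [r], paid by [sg * h]. *)
rewrite /usup /psi_at stepcost0 subr0 addr0 -(addrA s p h) psi_shift -/S2.
have : 0 <= B * (2 + `|d|) * h * h by rewrite !mulr_ge0 ?addr_ge0// ltW.
have : sg * h = h * (Ke a d * (S ^+ 3 + e * S + h)) + B * (2 + `|d|) * h * h.
  by rewrite /sg; ring.
move: r; set st1 := stepcost a d s p; set st2 := stepcost a d s (p + h).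
set ps := psi a d s (c :: cs); set et := eta * _.
set rr := h * (Ke a d * _).
lra.
Qed.

(** The disrupted state is here [(s + p, h)] and not [(s + p + h, 0)] as in [residual]. The values
    differ by O(h) and carry the weight [q <= B * h]; the second summand of [sg] pays for this. *)
Lemma usub_run : p + h < c ->
  usub s p (c :: cs) <=
  (1 - q) * usub s (p + h) (c :: cs) + q * usub (s + p) h (c :: cs).
Proof.
move=> phc.
have [s0_ p0_ pc_ c0_] : [/\ 0 <= s, 0 <= p, p <= c & 0 <= c] by [].
have hc_ : h < c by case: st => _ _ _ /andP[].
have [S0_ h0_ hS_ sp_] : [/\ 0 < S, 0 < h, h <= S & s + p + h <= 4 * S] by [].
have [sum0_ csS_ q2_] : [/\ 0 <= \sum_(x <- cs) x, c + \sum_(x <- cs) x <= S & q <= 1 / 2] by [].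
 have := residual phc; rewrite ler_norml => /andP[r _].
have /andP[S20 S2S] : 0 <= S2 <= S ^+ 2.
  by apply: sum_sqr_le => //; rewrite big_cons.
have SS2 : S ^+ 2 <= 1 by rewrite expr_le1// ltW.
have sp0 : 0 <= s + p by lra.
have sp5 : s + p <= 5 * S by lra.
have h5 : h <= 5 * S by lra.
have w1 := stepcost_le sp0 sp5 (ltW h0) h5.
have w2 : d * h * S2 / 2 <= `|d| * h.
  have n1 : 0 <= h * S2 / 2 by rewrite !mulr_ge0// ltW.
  have n2 : h * S2 / 2 <= h.
    have : h * S2 <= h * 1 by rewrite ler_wpM2l ?(ltW h0)//; lra.
    by have := h0; lra.
  have := normM_ge0_le d n1 n2; rewrite ler_norml => /andP[_].
  by lra.
have w : q * (h + d * h * S2 / 2 + stepcost a d (s + p) h) <= B * h * ((2 + `|d|) * h).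
  apply: (@le_trans _ _ (q * ((2 + `|d|) * h))).
    by rewrite ler_wpM2l//; move: w1 w2; lra.
  by rewrite ler_wpM2r// mulr_ge0 ?addr_ge0// ltW.
have shE : psi a d (s + p) (c :: cs) = psi a d s (c :: cs) + p + d * p * S2 / 2.
  by rewrite psi_shift.
rewrite /usub /psi_at shE.
have : sg * h = h * (Ke a d * (S ^+ 3 + e * S + h)) + B * h * ((2 + `|d|) * h).
  by rewrite /sg; ring.
move: r w; set st1 := stepcost a d s p; set st2 := stepcost a d s (p + h).
set st3 := stepcost a d (s + p) h.
set ps := psi a d s (c :: cs); set et := eta * _.
set rr := h * (Ke a d * _); set bb := B * h * _.
lra.
Qed.

End Analysis.

(** * Two-sided bound of the expected makespan by the expansion *)

Section Sandwich.
Context dd (T : measurableType dd) (R : realType) (P : probability T R).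
Context (lam : R -> R) (N : T -> R -> nat).
Hypothesis NP : is_nhpp P lam N.
Variables (a d B : R).
Hypothesis lam0 : forall x, 0 < x -> 0 <= lam x.
Hypothesis lamB : forall x, 0 < x -> lam x <= B.

Let B0 : 0 <= B. Proof. exact: le_trans (lam0 ltr01) (lamB ltr01). Qed.

Variables (cs : seq R) (h dl : R) (m : nat).
Let S : R := \sum_(c <- cs) c.
Hypothesis cs_gt0 : all (fun c => 0 < c) cs.
Hypothesis S0 : 0 < S.
Hypothesis S1 : S <= 1.
Hypothesis h0 : 0 < h.
Hypothesis hS : h <= S.
Hypothesis dS : `|d| * (15 * S) <= a.
Hypothesis KS : Kl a d * S <= 1.
Hypothesis BS : B * S <= 1 / 2.
Hypothesis dl0 : 0 <= dl.
Hypothesis lamE : forall u, 0 < u -> u <= 4 * S -> `|lam u - a - d * u| <= dl * u.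
Hypothesis mh : (4 * m)%:R * h = 4 * S.
Hypothesis hcs : all (fun c => h < c) cs.

Definition grid_err : R := 4 * dl * S + (`|d| + B ^+ 2) * h.
Definition slope_err : R :=
  Ke a d * (S ^+ 3 + grid_err * S + h) + B * (2 + `|d|) * h.

Let cs0 : all (fun c => 0 <= c) cs. Proof. by apply: sub_all cs_gt0 => x /ltW. Qed.

Let e0 : 0 <= grid_err.
Proof.
have [? ? ?] : [/\ 0 <= S, 0 <= h & 0 <= B] by split => //; exact: ltW.
by rewrite /grid_err addr_ge0 ?mulr_ge0 ?addr_ge0 ?exprn_ge0.
Qed.

Let slope0 : 0 <= slope_err.
Proof.
have [? ? ?] : [/\ 0 <= S, 0 <= h & 0 <= B] by split => //; exact: ltW.
apply: addr_ge0.
  apply: mulr_ge0; first exact: Ke_ge0.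
  by rewrite !addr_ge0// ?exprn_ge0// mulr_ge0.
by apply: mulr_ge0 => //; apply: mulr_ge0 => //; exact: addr_ge0.
Qed.

Local Notation q k := (cell_prob lam h k false).

Let q1 k : cell_prob lam h k true = 1 - q k.
Proof. by rewrite /cell_prob; ring. Qed.

Let q_ge0 k : 0 <= q k.
Proof.
rewrite /cell_prob subr_ge0 -expR0 ler_expR oppr_le0.
exact: (cell_mean_ge0 (ltW h0) lam0 lamB).
Qed.

Let qB k : q k <= B * h. Proof. exact: (cell_prob_false_le lam0 lamB _ (ltW h0)). Qed.

Let khS k : (k < 4 * m)%N -> k%:R * h + h <= 4 * S.
Proof.
by move=> k4; rewrite -mh -{2}(mul1r h) -mulrDl natr1 ler_wpM2r ?ler_nat// ltW.
Qed.

Let q_approx k s p : (k < 4 * m)%N -> s + p = k%:R * h ->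
  `|q k - h * (a + d * (s + p + h))| <= h * grid_err.
Proof. by move=> k4 ->; apply: cell_prob_approx => //; exact: khS. Qed.

Let Psi := psi a d 0 cs.
(** The corrections in [usup] and [usub] at the initial state, plus the truncation error. *)
Let err := 12 * h * (size cs)%:R + slope_err * (4 * S) + 2 * S * (B * S) ^+ 4.

Let psi_at0 : psi_at a d 0 0 cs = Psi.
Proof. by rewrite /psi_at /Psi; case: cs => //= *; rewrite stepcost0 subr0. Qed.

Let sum_ge0 (l : seq R) : all (fun c => h < c) l -> 0 <= \sum_(x <- l) x.
Proof.
by move=> hl; rewrite big_seq sumr_ge0// => x /(allP hl)/ltW; apply: le_trans; exact: ltW.
Qed.

(** The two sides are the end conditions of the upper and of the lower recursion, the latter with
    [M = 2 * S]. *)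
Let end_bounds s p c cs' : state_ok h S s p c cs' -> s + p = 4 * S ->
  s + p <= psi_at a d s p (c :: cs') <= s + p + 2 * S.
Proof.
move=> [s0 p0 pc hcs' sumS] spS.
have [S0_ h0_] : 0 < S /\ 0 < h by [].
have /andP[hc hcs2] := hcs'.
have sum0 := sum_ge0 hcs2.
move: sumS; rewrite big_cons => sumS.
have c0 : 0 <= c by lra.
have s5 : s <= 5 * S by lra.
have c5 : c <= 5 * S by lra.
have p5 : p <= 5 * S by lra.
have w1 := le_stepcost S0 dS s0 s5 p0 (ltW pc) c5.
have w2 := stepcost_ge0 S0 dS s0 s5 p0 p5.
have cs0' : all (fun c => 0 <= c) (c :: cs').
  by apply: sub_all hcs' => x /ltW; apply: le_trans; exact: ltW.
have tS : s + c + \sum_(x <- cs') x <= 5 * S by lra.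
have tS' : s + \sum_(x <- c :: cs') x <= 5 * S by rewrite big_cons; lra.
have sc0 : 0 <= s + c by lra.
have /andP[b1 b2] := psi_bounds S0 S1 dS KS (andP cs0').2 sc0 tS.
have /andP[b3 b4] := psi_bounds S0 S1 dS KS cs0' s0 tS'.
move: b3 b4; rewrite big_cons /psi_at /= => b3 b4.
by apply/andP; split; lra.
Qed.

Lemma makespan_le_psi :
  (\int[P]_w completion (N w) 0 cs <= (Psi + err)%:E)%E.
Proof.
apply: le_trans (makespan_le NP lam0 lamB cs0 S0 BS B0 (m := m)
  (U := usup a d B S h grid_err) h0 mh hcs _ _ _ _) _.
- move=> s p s0; rewrite mh -/S => spL.
  rewrite /usup mulr0 addr0 lerDl mulr_ge0 ?subr_ge0//.
- move=> s p c cs' st; rewrite mh -/S => spL.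
  have /andP[+ _] := end_bounds st spL; rewrite /usup spL subrr mulr0 addr0 => /le_trans.
  by apply; rewrite lerDl !mulr_ge0// ltW.
- move=> k s p c cs' k4 spk st phc; rewrite q1.
  apply: usup_run => //; last exact: q_approx.
  by rewrite spk; exact: khS.
- move=> k s p c cs' k4 spk st cph; rewrite q1.
  apply: usup_cross => //.
  by rewrite spk; exact: khS.
rewrite lee_fin le_eqVlt; apply/orP; left; apply/eqP.
by rewrite /usup psi_at0 /err /slope_err /S; ring.
Qed.

Lemma makespan_ge_psi :
  ((Psi - err)%:E <= \int[P]_w completion (N w) 0 cs)%E.
Proof.
apply: le_trans (makespan_ge NP lam0 lamB cs0 (m := m)
  (U := usub a d B S h grid_err) h0 mh hcs _ _ _ _).
- rewrite lee_fin le_eqVlt; apply/orP; left; apply/eqP.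
  by rewrite /usub psi_at0 /err /slope_err /S; ring.
- move=> s p s0; rewrite mh -/S => spL.
  rewrite /usub mulr0 subr0 gerBl mulr_ge0 ?subr_ge0//.
- move=> s p c cs' st; rewrite mh -/S => spL.
  have /andP[_] := end_bounds st spL; rewrite /usub spL subrr mulr0 subr0.
  by apply: le_trans; rewrite gerBl !mulr_ge0// ltW.
- move=> k s p c cs' k4 spk st phc; rewrite q1.
  apply: usub_run => //; last exact: q_approx.
  by rewrite spk; exact: khS.
- move=> k s p c cs' k4 spk st cph; rewrite q1.
  apply: usub_cross => //.
  by rewrite spk; exact: khS.
Qed.

End Sandwich.

(** * The expansion with error o(S^3), uniform over batches *)

Lemma exists_lt_all (R : realType) (cs : seq R) :
  all (fun c => 0 < c) cs -> exists2 x : R, 0 < x & all (fun c => x < c) cs.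
Proof.
elim: cs => [|c cs IH] /=; first by exists 1.
move=> /andP[c0 /IH[x x0 xcs]]; exists (Num.min x (c / 2)).
  by rewrite lt_min x0 divr_gt0.
rewrite gt_min; apply/andP; split.
  by apply/orP; right; rewrite ltr_pdivrMr// mulr_natr mulr2n ltrDl.
by apply: sub_all xcs => y; apply: le_lt_trans; rewrite ge_min lexx.
Qed.

(** [S0] depends on the intensity and [ep] only, so the estimate is uniform in the batch and its
    order. The mesh is absent from the conclusion and is chosen last, depending on the batch. *)
Lemma makespan_expansion dd (T : measurableType dd) (R : realType)
    (P : probability T R) (lam : R -> R) (N : T -> R -> nat) (a d B : R) :
  is_nhpp P lam N -> 0 < a ->
  (forall x, 0 < x -> 0 <= lam x) -> (forall x, 0 < x -> lam x <= B) ->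
  (forall dl, 0 < dl -> exists2 u0 : R, 0 < u0 &
     forall u, 0 < u -> u <= u0 -> `|lam u - a - d * u| <= dl * u) ->
  forall ep, 0 < ep -> exists2 S0 : R, 0 < S0 &
    forall cs : seq R, all (fun c => 0 < c) cs ->
      0 < \sum_(c <- cs) c -> \sum_(c <- cs) c <= S0 ->
    ((psi a d 0 cs - ep * (\sum_(c <- cs) c) ^+ 3)%:E
       <= \int[P]_w completion (N w) 0 cs)%E /\
    (\int[P]_w completion (N w) 0 cs
       <= (psi a d 0 cs + ep * (\sum_(c <- cs) c) ^+ 3)%:E)%E.
Proof.
move=> NP a0 lam0 lamB lamE ep ep0.
have B0 : 0 <= B by exact: le_trans (lam0 1 ltr01) (lamB 1 ltr01).
have Ke0 := Ke_ge0 a d; have Kl0 := Kl_ge0 a d; have dn0 := normr_ge0 d.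
(* The linearisation error enters [slope_err * (4 * S)] with coefficient [16 * Ke a d]; this choice
   keeps it within a quarter of [ep]. *)
pose dl := ep / (64 * (Ke a d + 1)).
have dl0 : 0 < dl by rewrite divr_gt0// mulr_gt0// ltr_wpDl.
have Kdl : 16 * Ke a d * dl <= ep / 4.
  have -> : ep / 4 = 16 * (Ke a d + 1) * dl by rewrite /dl; field; lra.
  by apply: ler_wpM2r; [exact: ltW|rewrite ler_wpM2l// lerDl].
have [u0 u00 lamu] := lamE dl dl0.
(* Through [DS], each summand yields one of the smallness conditions on [S]. *)
pose D := 1 + `|d| * 15 / a + Kl a d + 2 * B + 4 / u0 + 16 * Ke a d / ep + 8 * B ^+ 4 / ep.
have [i1 i2 i3 i4] : [/\ 0 <= `|d| * 15 / a, 0 <= 4 / u0, 0 <= 16 * Ke a d / ep &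
    0 <= 8 * B ^+ 4 / ep].
  have [? ? ?] : [/\ 0 <= a, 0 <= u0 & 0 <= ep] by split => //; exact: ltW.
  by split; rewrite divr_ge0 ?mulr_ge0 ?exprn_ge0.
have D1 : 1 <= D by rewrite /D; lra.
have D0 : 0 < D by lra.
exists D^-1; first by rewrite invr_gt0.
move=> cs cs0; set S := \sum_(c <- cs) c => S0 SD.
have DS x : 0 <= x -> x <= D -> x * S <= 1.
  move=> x0 xD; apply: (@le_trans _ _ (D * D^-1)); last by rewrite divff ?gt_eqF.
  by apply: ler_pM => //; exact: ltW.
have S1 : S <= 1 by rewrite -[leLHS]mul1r DS.
have dS : `|d| * (15 * S) <= a.
  have : `|d| * 15 / a * S <= 1 by apply: DS => //; rewrite /D; lra.
  by rewrite mulrAC ler_pdivrMr// mul1r -mulrA.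
have KS : Kl a d * S <= 1 by apply: DS => //; rewrite /D; lra.
have BS : B * S <= 1 / 2.
  have : 2 * B * S <= 1 by apply: DS; rewrite /D; lra.
  lra.
have uS : 4 * S <= u0.
  have : 4 / u0 * S <= 1 by apply: DS => //; rewrite /D; lra.
  by rewrite mulrAC ler_pdivrMr// mul1r.
have KeS : 4 * Ke a d * S <= ep / 4.
  have : 16 * Ke a d / ep * S <= 1 by apply: DS => //; rewrite /D; lra.
  by rewrite mulrAC ler_pdivrMr// mul1r; lra.
have B4S : 2 * B ^+ 4 * S <= ep / 4.
  have : 8 * B ^+ 4 / ep * S <= 1 by apply: DS => //; rewrite /D; lra.
  by rewrite mulrAC ler_pdivrMr// mul1r; lra.
have [x x0 xcs] := exists_lt_all cs0.
(* All coefficients of [h] in the error, after [S <= 1]. *)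
pose H := 12 * (size cs)%:R + 4 * (Ke a d * (`|d| + B ^+ 2 + 1) + B * (2 + `|d|)).
have H0 : 0 <= H.
  have B20 : 0 <= B ^+ 2 by exact: exprn_ge0.
  have v1 : 0 <= Ke a d * (`|d| + B ^+ 2 + 1) by rewrite mulr_ge0// !addr_ge0.
  have v2 : 0 <= B * (2 + `|d|) by rewrite mulr_ge0// addr_ge0.
  have v3 : 0 <= (size cs)%:R :> R by [].
  by rewrite /H; lra.
have S30 : 0 < S ^+ 3 by rewrite exprn_gt0.
pose y := Num.min x (ep / 4 * S ^+ 3 / (H + 1)).
have y0 : 0 < y by rewrite lt_min x0 !(divr_gt0, mulr_gt0)// ltr_wpDl.
(* The mesh must divide [S] and stay below [y], that is, below every task and small against
   [S ^+ 3]. *)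
pose m := (Num.trunc (S / y)).+1.
pose h := S / m%:R.
have m0 : 0 < m%:R :> R by rewrite ltr0n.
have h0 : 0 < h by rewrite divr_gt0.
have hy : h < y.
  by rewrite /h ltr_pdivrMr// mulrC -ltr_pdivrMr//; exact: truncnS_gt.
have m1 : 1 <= m%:R :> R by rewrite ler1n.
have hS : h <= S by rewrite /h ler_pdivrMr// ler_peMr// ltW.
have mh : (4 * m)%:R * h = 4 * S by rewrite natrM /h; field; exact: lt0r_neq0.
have hcs : all (fun c => h < c) cs.
  apply: sub_all xcs => c; apply: lt_trans; apply: (lt_le_trans hy).
  by rewrite ge_min lexx.
have hH : h * H <= ep / 4 * S ^+ 3.
  apply: (@le_trans _ _ (h * (H + 1))); first by rewrite ler_wpM2l ?lerDl// ltW.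
  rewrite -ler_pdivlMr ?ltr_wpDl//; apply: ltW; apply: (lt_le_trans hy).
  by rewrite ge_min lexx orbT.
have lamS u : 0 < u -> u <= 4 * S -> `|lam u - a - d * u| <= dl * u.
  by move=> u_gt0 uS'; apply: lamu => //; exact: le_trans uS.
(* One quarter of [ep] each for the quartic residual, the linearisation, the truncation and the
   mesh. *)
have err : 12 * h * (size cs)%:R + slope_err a d B cs h dl * (4 * S)
    + 2 * S * (B * S) ^+ 4 <= ep * S ^+ 3.
  have SS : S * S <= S by rewrite ler_piMl// ltW.
  have e1 : 4 * Ke a d * S * S ^+ 3 <= ep / 4 * S ^+ 3 by rewrite ler_wpM2r// ltW.
  have e2 : 16 * Ke a d * dl * S ^+ 3 <= ep / 4 * S ^+ 3 by rewrite ler_wpM2r// ltW.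
  have e3 : 2 * B ^+ 4 * S * (S * S ^+ 3) <= ep / 4 * S ^+ 3.
    apply: ler_pM => //.
    - by rewrite !mulr_ge0 ?exprn_ge0// ltW.
    - by rewrite mulr_ge0// ltW.
    - by rewrite ler_piMl// ltW.
  pose Y := Ke a d * (`|d| + B ^+ 2).
  have Y0 : 0 <= Y by rewrite mulr_ge0// addr_ge0// exprn_ge0.
  have e4 : Y * h * (S * S) <= Y * h * 1.
    by apply: ler_wpM2l; [rewrite mulr_ge0// ltW|exact: le_trans SS S1].
  pose V := Ke a d + B * (2 + `|d|).
  have V0 : 0 <= V by rewrite addr_ge0// mulr_ge0// addr_ge0.
  have e5 : V * h * S <= V * h * 1.
    by apply: ler_wpM2l => //; rewrite mulr_ge0// ltW.
  have e6 : Y * h * S * S <= Y * h by rewrite -mulrA; move: e4; rewrite mulr1.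
  have -> : 12 * h * (size cs)%:R + slope_err a d B cs h dl * (4 * S)
    + 2 * S * (B * S) ^+ 4 = 4 * Ke a d * S * S ^+ 3 + 16 * Ke a d * dl * S ^+ 3
    + 2 * B ^+ 4 * S * (S * S ^+ 3) + (12 * (size cs)%:R * h
    + 4 * (Y * h * S * S) + 4 * (V * h * S)).
    by rewrite /slope_err /grid_err -/S /Y /V; ring.
  have HE : h * H = 12 * (size cs)%:R * h + 4 * (Y * h) + 4 * (V * h).
    by rewrite /H /Y /V; ring.
  move: e1 e2 e3 e5 e6 hH; rewrite HE.
  set z1 := 4 * Ke a d * S * _; set z2 := 16 * Ke a d * dl * _.
  set z3 := 2 * B ^+ 4 * S * _; set z4 := 12 * _ * h.
  set z5 := Y * h * S * S; set z6 := V * h * S; set z7 := Y * h; set z8 := V * h.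
  lra.
split.
  apply: le_trans (makespan_ge_psi NP lam0 lamB cs0 S0 S1 h0 hS dS KS BS (ltW dl0)
    lamS mh hcs).
  by rewrite lee_fin lerD2l lerN2.
apply: le_trans (makespan_le_psi NP lam0 lamB cs0 S0 S1 h0 hS dS KS BS (ltW dl0)
    lamS mh hcs) _.
by rewrite lee_fin lerD2l.
Qed.

(** * Dependence of the expansion on the order of the tasks *)

Section Orders.
Context {R : realType}.

Fixpoint lsum (s : R) (cs : seq R) : R :=
  if cs is c :: cs' then c * (s + c) ^+ 2 + lsum (s + c) cs' else 0.

(** All terms but [lsum s cs] are symmetric in the tasks, so the order enters only through
    [d / 2 * lsum s cs]. *)
Lemma psiE (a d s : R) cs : psi a d s cs =
  s + \sum_(c <- cs) c + a * (\sum_(c <- cs) c ^+ 2) / 2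
  + a ^+ 2 * (\sum_(c <- cs) c ^+ 3) / 6
  + d * (lsum s cs / 2 - ((s + \sum_(c <- cs) c) ^+ 3 - s ^+ 3) / 6).
Proof.
elim: cs s => [|c cs IH] s /=; first by rewrite !big_nil; field.
by rewrite !big_cons IH /stepcost; field.
Qed.

Lemma lsum_nth (s : R) cs : lsum s cs =
  \sum_(i < size cs) cs`_i * (s + \sum_(k < size cs | (k <= i)%N) cs`_k) ^+ 2.
Proof.
elim: cs s => [|c cs IH] s /=; first by rewrite big_ord0.
rewrite big_ord_recl /= IH; congr (_ * (_ + _) ^+ 2 + _).
  by rewrite big_mkcond big_ord_recl /= big1 ?addr0.
apply: eq_bigr => i _; congr (_ * _ ^+ 2).
rewrite [in RHS]big_mkcond [in RHS]big_ord_recl /= -addrA; congr (_ + (_ + _)).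
by rewrite -big_mkcond.
Qed.

(** Expanding the squares leaves, besides symmetric terms, [x * y ^+ 2] for every pair with [x]
    before [y]. *)
Lemma lsum_pairs (s : R) cs : lsum s cs =
  ((s + \sum_(c <- cs) c) ^+ 3 - s ^+ 3) / 3 + s * \sum_(c <- cs) c ^+ 2
  + 2 / 3 * \sum_(c <- cs) c ^+ 3
  + \sum_(i < size cs) \sum_(k < size cs | (k < i)%N) cs`_k * cs`_i ^+ 2.
Proof.
elim: cs s => [|c cs IH] s /=; first by rewrite !big_nil big_ord0; field.
rewrite !big_cons IH big_ord_recl [\sum_(k < (size cs).+1 | (k < ord0)%N) _]big1 ?add0r//.
have -> : \sum_(i < size cs) \sum_(k < (size cs).+1 | (k < lift ord0 i)%N)
    (c :: cs)`_k * (c :: cs)`_(lift ord0 i) ^+ 2 = c * (\sum_(x <- cs) x ^+ 2) +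
    \sum_(i < size cs) \sum_(k < size cs | (k < i)%N) cs`_k * cs`_i ^+ 2.
  rewrite (big_nth 0) big_mkord mulr_sumr -big_split/=; apply: eq_bigr => i _.
  by rewrite big_mkcond big_ord_recl/= -big_mkcond.
by field.
Qed.

Context {n : nat} (abar : 'I_n -> R).
Hypothesis abar0 : forall i, 0 < abar i.
Hypothesis abar_lt : forall i j : 'I_n, (i < j)%N -> abar i < abar j.

Local Notation tasks pi := [seq abar (pi i) | i <- enum 'I_n].

Lemma nth_tasks (pi : 'S_n) (i : 'I_n) : (tasks pi)`_i = abar (pi i).
Proof. by rewrite (nth_map i) ?size_enum_ord// nth_ord_enum. Qed.

Lemma lsum_tasks (pi : 'S_n) : lsum 0 (tasks pi) = Ssum abar pi.
Proof.
rewrite lsum_nth size_map size_enum_ord; apply: eq_bigr => i _.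
rewrite nth_tasks add0r; congr (_ * _ ^+ 2); apply: eq_bigr => k _.
exact: nth_tasks.
Qed.

Lemma sum_tasks (F : R -> R) (pi : 'S_n) :
  \sum_(c <- tasks pi) F c = \sum_i F (abar i).
Proof. by rewrite big_map big_enum [RHS](reindex_inj (@perm_inj _ pi)). Qed.

(** [pi^-1 u] is the position of task [u]. The cost is symmetric in [u] and [v], so a double sum
    counts each pair twice. *)
Definition pair_cost (pi : 'S_n) (u v : 'I_n) : R :=
  if (pi^-1%g u < pi^-1%g v)%N then abar u * abar v ^+ 2
  else if (pi^-1%g v < pi^-1%g u)%N then abar v * abar u ^+ 2 else 0.

(** Indexing by tasks instead of positions makes two permutations comparable term by term. *)
Lemma Ssum_pairs (pi : 'S_n) : Ssum abar pi =
  (\sum_i abar i) ^+ 3 / 3 + 2 / 3 * (\sum_i abar i ^+ 3)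
  + (\sum_u \sum_v pair_cost pi u v) / 2.
Proof.
have s1 : \sum_(c <- tasks pi) c = \sum_i abar i := sum_tasks id pi.
rewrite -lsum_tasks lsum_pairs s1 (sum_tasks (fun x => x ^+ 3)).
rewrite add0r expr0n subr0 mul0r addr0; congr (_ + _).
rewrite size_map size_enum_ord.
pose g (i k : 'I_n) := if (k < i)%N then abar (pi k) * abar (pi i) ^+ 2 else 0.
have -> : \sum_(i < n) \sum_(k < n | (k < i)%N) (tasks pi)`_k * (tasks pi)`_i ^+ 2
    = \sum_i \sum_k g i k.
  apply: eq_bigr => i _; rewrite big_mkcond; apply: eq_bigr => k _.
  by rewrite !nth_tasks.
have -> : \sum_u \sum_v pair_cost pi u v = \sum_i \sum_k (g i k + g k i).
  rewrite (reindex_inj (@perm_inj _ pi)); apply: eq_bigr => i _.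
  rewrite (reindex_inj (@perm_inj _ pi)); apply: eq_bigr => k _.
  rewrite /pair_cost !permK /g.
  by case: (ltngtP i k) => _; rewrite ?addr0 ?add0r.
under [in RHS]eq_bigr do rewrite big_split.
rewrite big_split /= [X in (_ + X) / 2]exchange_big /=.
by field.
Qed.

Lemma pair_lt (u v : 'I_n) : (u < v)%N ->
  abar v * abar u ^+ 2 < abar u * abar v ^+ 2.
Proof.
move=> uv; rewrite -subr_gt0.
have -> : abar u * abar v ^+ 2 - abar v * abar u ^+ 2 =
  abar u * abar v * (abar v - abar u) by ring.
by rewrite !mulr_gt0 ?subr_gt0 ?abar_lt.
Qed.

Lemma mono_ord_le (g : 'I_n -> 'I_n) :
  (forall u v : 'I_n, (u < v)%N -> (g u < g v)%N) -> forall u : 'I_n, (u <= g u)%N.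
Proof.
move=> gm [u un]; elim: u un => [//|u IH] un.
exact: leq_ltn_trans (IH (ltnW un)) (gm (Ordinal (ltnW un)) (Ordinal un) (ltnSn u)).
Qed.

(** Conjugation by [rev_ord] turns [mono_ord_le] into the opposite inequality. *)
Lemma mono_ord_id (g : 'I_n -> 'I_n) :
  (forall u v : 'I_n, (u < v)%N -> (g u < g v)%N) -> g =1 id.
Proof.
move=> gm u; apply/val_inj/eqP; rewrite eqn_leq; apply/andP; split; last exact: mono_ord_le.
have := @mono_ord_le (fun v => rev_ord (g (rev_ord v))) _ (rev_ord u).
rewrite rev_ordK => H.
have {}H : (rev_ord u <= rev_ord (g u))%N.
  apply: H => v w vw; have : (rev_ord w < rev_ord v)%N.
    by rewrite /=; have := ltn_ord w; lia.
  move=> /gm /=; have := ltn_ord (g (rev_ord v)); lia.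
move: H => /=; have := ltn_ord u; have := ltn_ord (g u); lia.
Qed.

(** Without inversions [pi^-1] would be strictly increasing, hence the identity. *)
Lemma exists_inversion (pi : 'S_n) : pi != 1%g ->
  exists u v : 'I_n, (u < v)%N /\ (pi^-1%g v < pi^-1%g u)%N.
Proof.
move=> pi1; apply: contrapT => noinv; move/eqP: pi1; apply.
have mono : pi^-1%g =1 id.
  apply: mono_ord_id => u v uv; rewrite ltnNge leq_eqVlt negb_or.
  apply/andP; split; last by apply/negP => lt; apply: noinv; exists u, v.
  by apply/eqP => /val_inj/perm_inj vu; rewrite vu ltnn in uv.
by apply/permP => i; rewrite perm1 -{1}(mono i) permKV.
Qed.

(** Otherwise [pi^-1] followed by [rev_ord] would be strictly increasing. *)
Lemma exists_noninversion (pi : 'S_n) : pi != revperm n ->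
  exists u v : 'I_n, (u < v)%N /\ (pi^-1%g u < pi^-1%g v)%N.
Proof.
move=> pi1; apply: contrapT => noinv; move/eqP: pi1; apply.
have mono : (fun u => rev_ord (pi^-1%g u)) =1 id.
  apply: mono_ord_id => u v uv.
  have : ~~ (pi^-1%g u < pi^-1%g v)%N by apply/negP => lt; apply: noinv; exists u, v.
  have : pi^-1%g u != pi^-1%g v :> nat.
    by apply/eqP => /val_inj/perm_inj vu; rewrite vu ltnn in uv.
  by rewrite /=; have := ltn_ord (pi^-1%g u); lia.
apply/permP => i; rewrite permE -{1}(rev_ordK i) -[in LHS](mono (rev_ord i)) rev_ordK.
by rewrite permKV.
Qed.

Let sum2_lt (F G : 'I_n -> 'I_n -> R) u0 v0 :
  (forall u v, F u v <= G u v) -> F u0 v0 < G u0 v0 ->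
  \sum_u \sum_v F u v < \sum_u \sum_v G u v.
Proof.
move=> FG lt0; rewrite (bigD1 u0)//= [ltRHS](bigD1 u0)//=.
apply: ltr_leD; last by apply: ler_sum => u _; apply: ler_sum => v _.
rewrite (bigD1 v0)//= [ltRHS](bigD1 v0)//=.
by apply: ltr_leD => //; apply: ler_sum => v _.
Qed.

(** The identity gives every pair the larger of its two possible costs, and an inversion makes one
    pair strictly cheaper. *)
Lemma Ssum_lt_id (pi : 'S_n) : pi != 1%g -> Ssum abar pi < Ssum abar 1%g.
Proof.
move=> /exists_inversion[u0 [v0 [uv0 inv0]]].
rewrite !Ssum_pairs ltrD2l ltr_pM2r ?invr_gt0//.
apply: (@sum2_lt _ _ u0 v0).
  move=> u v; rewrite /pair_cost invg1 !perm1.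
  case: (ltngtP u v) => [uv|uv|/val_inj ->]; last by rewrite ltnn.
    by case: ltngtP => _ //; [exact/ltW/pair_lt|rewrite mulr_ge0// ?exprn_ge0// ltW].
  by case: ltngtP => _ //; [exact/ltW/pair_lt|rewrite mulr_ge0// ?exprn_ge0// ltW].
rewrite /pair_cost invg1 !perm1 uv0 inv0 ltnNge (ltnW inv0)/=.
exact: pair_lt.
Qed.

Lemma revpermV (u : 'I_n) : (revperm n)^-1%g u = rev_ord u.
Proof. by apply: (@perm_inj _ (revperm n)); rewrite permKV permE rev_ordK. Qed.

Lemma Ssum_lt_rev (pi : 'S_n) : pi != revperm n ->
  Ssum abar (revperm n) < Ssum abar pi.
Proof.
move=> /exists_noninversion[u0 [v0 [uv0 inv0]]].
have revlt (u v : 'I_n) : (rev_ord u < rev_ord v)%N = (v < u)%N.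
  by rewrite /=; have := ltn_ord u; have := ltn_ord v; lia.
rewrite !Ssum_pairs ltrD2l ltr_pM2r ?invr_gt0//.
apply: (@sum2_lt _ _ u0 v0).
  move=> u v; rewrite /pair_cost !revpermV !revlt.
  case: (ltngtP u v) => [uv|uv|/val_inj ->]; last by rewrite ltnn.
    case: ltngtP => [_|_|/val_inj/perm_inj e] //; first exact/ltW/pair_lt.
    by rewrite e ltnn in uv.
  case: ltngtP => [_|_|/val_inj/perm_inj e] //; first exact/ltW/pair_lt.
  by rewrite e ltnn in uv.
rewrite /pair_cost !revpermV !revlt inv0 uv0 ltnNge (ltnW uv0)/=.
exact: pair_lt.
Qed.

(** Reversal turns prefix sums into suffix sums. *)
Lemma Ssum_revE : \sum_(i < n) abar (rev_ord i)
    * (\sum_(k < n | (rev_ord i <= k)%N) abar k) ^+ 2 = Ssum abar (revperm n).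
Proof.
apply: eq_bigr => i _; rewrite permE; congr (_ * _ ^+ 2).
rewrite /Apref (reindex_inj rev_ord_inj); apply: eq_big => [k|k _].
  by rewrite /=; have := ltn_ord i; have := ltn_ord k; lia.
by rewrite permE.
Qed.

End Orders.

(** * Comparison of schedules at small scale *)

Section Comparison.
Context {R : realType} {n : nat} (abar : 'I_n -> R).
Hypothesis abar0 : forall i, 0 < abar i.

Let A : R := \sum_i abar i.

(** The symmetric terms of [psiE] cancel, and [lsum] is homogeneous of degree 3. *)
Lemma psi_sched (a d eps : R) (pi sigma : 'S_n) :
  psi a d 0 (sched abar eps pi) - psi a d 0 (sched abar eps sigma) =
  eps ^+ 3 * (d / 2 * (Ssum abar pi - Ssum abar sigma)).
Proof.
have lsum_scale s cs : lsum (eps * s) [seq eps * c | c <- cs] = eps ^+ 3 * lsum s cs.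
  elim: cs s => [|c cs IH] s /=; first by rewrite mulr0.
  by rewrite -mulrDr IH; ring.
have schedE tau : sched abar eps tau =
    [seq eps * c | c <- [seq abar (tau i) | i <- enum 'I_n]].
  by rewrite -map_comp.
have lsumE tau : lsum 0 (sched abar eps tau) = eps ^+ 3 * Ssum abar tau.
  by rewrite schedE -{1}(mulr0 eps) lsum_scale lsum_tasks.
have sumE (F : R -> R) tau :
    \sum_(c <- sched abar eps tau) F c = \sum_i F (eps * abar i).
  by rewrite schedE big_map (sum_tasks abar (fun c => F (eps * c))).
rewrite !psiE !lsumE !(sumE (fun c => c ^+ 2)) !(sumE (fun c => c ^+ 3)).
by rewrite !(sumE (fun c => c)); field.
Qed.

Lemma sum_sched (eps : R) (pi : 'S_n) : \sum_(c <- sched abar eps pi) c = eps * A.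
Proof.
rewrite big_map big_enum mulr_sumr /= [RHS](reindex_inj (@perm_inj _ pi)).
exact: eq_bigl.
Qed.

(** Since there are finitely many permutations, one [g > 0] makes the expansions differ by more than
    [eps ^+ 3 * g], while the error is only a third of this on either side. *)
Lemma eventually_optimal dd (T : measurableType dd) (P : probability T R)
    (lam : R -> R) (N : T -> R -> nat) (a d B : R) (sigma : 'S_n) :
  is_nhpp P lam N -> 0 < a ->
  (forall x, 0 < x -> 0 <= lam x) -> (forall x, 0 < x -> lam x <= B) ->
  (forall dl, 0 < dl -> exists2 u0 : R, 0 < u0 &
     forall u, 0 < u -> u <= u0 -> `|lam u - a - d * u| <= dl * u) ->
  (forall pi : 'S_n, pi != sigma -> 0 < d * (Ssum abar pi - Ssum abar sigma)) ->
  0 < A ->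
  exists2 eps0 : R, 0 < eps0 & forall eps, 0 < eps -> eps < eps0 ->
    forall pi : 'S_n, pi != sigma ->
      (exp_makespan P N 0%R (sched abar eps sigma)
         < exp_makespan P N 0%R (sched abar eps pi))%E.
Proof.
move=> NP a0 lam0 lamB lamE gap A0.
have [g g0 gall] : exists2 g : R, 0 < g & forall pi : 'S_n, pi != sigma ->
    g < d / 2 * (Ssum abar pi - Ssum abar sigma).
  have [|g g0 /allP gall] := @exists_lt_all R
    [seq d / 2 * (Ssum abar pi - Ssum abar sigma) | pi <- enum (predC1 sigma)].
    apply/allP => x /mapP[pi]; rewrite mem_enum => /gap H ->.
    by rewrite mulrAC divr_gt0.
  exists g => // pi pis; apply: gall; apply: map_f.
  by rewrite mem_enum.
have A30 : 0 < A ^+ 3 by rewrite exprn_gt0.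
pose ep := g / (3 * A ^+ 3).
have ep0 : 0 < ep by rewrite divr_gt0// mulr_gt0.
have [S0 S00 H] := makespan_expansion NP a0 lam0 lamB lamE ep0.
exists (S0 / A); first by rewrite divr_gt0.
move=> eps eps0 epsS pi pis.
have mk cs : exp_makespan P N 0 cs = (\int[P]_w completion (N w) 0 cs)%E.
  by apply: eq_integral => w _; rewrite sube0.
have sch tau : all (fun c => 0 < c) (sched abar eps tau).
  by apply/allP => _ /mapP[i _ ->]; rewrite mulr_gt0.
have eA0 : 0 < eps * A by rewrite mulr_gt0.
have eAS : eps * A <= S0 by rewrite -ler_pdivlMr// ltW.
have s1 tau : 0 < \sum_(c <- sched abar eps tau) c by rewrite sum_sched.
have s2 tau : \sum_(c <- sched abar eps tau) c <= S0 by rewrite sum_sched.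
have [_ up] := H _ (sch sigma) (s1 sigma) (s2 sigma).
have [lo _] := H _ (sch pi) (s1 pi) (s2 pi).
rewrite !mk; apply: le_lt_trans up _; apply: lt_le_trans lo.
rewrite lte_fin !sum_sched.
have epE : ep * (eps * A) ^+ 3 = eps ^+ 3 * (g / 3).
  by rewrite /ep; field; exact: lt0r_neq0.
have : eps ^+ 3 * g < eps ^+ 3 * (d / 2 * (Ssum abar pi - Ssum abar sigma)).
  by rewrite ltr_pM2l ?exprn_gt0//; exact: gall.
have : 0 < eps ^+ 3 * g by rewrite mulr_gt0// exprn_gt0.
by rewrite -(psi_sched a) epE; lra.
Qed.

End Comparison.

(** * Linearisation at the origin and the sign of the slope *)

Lemma right_derivative_bound (R : realType) (f : R -> R) (df0 : R) :
  h^-1 * (f h - f 0) @[h --> 0^'+] --> df0 ->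
  forall dl, 0 < dl -> exists2 u0 : R, 0 < u0 &
    forall u, 0 < u -> u <= u0 -> `|f u - f 0 - df0 * u| <= dl * u.
Proof.
move=> /cvgrPdist_le df dl dl0.
have [/= e e0 He] := df dl dl0.
exists (e / 2); first by rewrite divr_gt0.
move=> u u0 ue.
have : ball (0 : R) e u.
  rewrite /ball /= sub0r normrN gtr0_norm//; apply: (le_lt_trans ue).
  by rewrite ltr_pdivrMr// mulr_natr mulr2n ltrDl.
move=> /He /(_ u0) H.
have -> : f u - f 0 - df0 * u = - ((df0 - u^-1 * (f u - f 0)) * u).
  by field; exact: lt0r_neq0.
by rewrite normrN normrM (gtr0_norm u0) ler_wpM2r// ltW.
Qed.

Theorem theorem2 (R : realType) (n : nat) (abar : 'I_n -> R)
  (eps1 lbar : R) (f : R -> R) (df0 : R) :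
  (forall i, 0 < abar i) ->
  (forall i j : 'I_n, (i < j)%N -> abar i < abar j) ->
  0 < eps1 -> 0 < lbar ->
  (forall t, 0 <= t -> 0 < f t) ->
  (forall t, 0 < t -> derivable f t 1) ->
  h^-1 * (f h - f 0) @[h --> 0^'+] --> df0 ->
  0 < inf [set f t | t in [set t : R | 0 <= t]] ->
  has_ubound [set f t | t in [set t : R | 0 <= t]] ->
  let fplus := sup [set f t | t in [set t : R | 0 <= t]] in
  let Abarn := \sum_(i < n) abar i in
  let num := 2 * lbar * (fplus ^+ 2 * Abarn * (\sum_(i < n) abar i ^+ 2)
                          + fplus ^+ 2 * (3 / 4) * Abarn ^+ 3) in
  (* (i) SPT *)
  ((forall x y, 0 <= x -> x < y -> y <= eps1 * Abarn -> f y < f x) ->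
   (forall pi : 'S_n, pi != 1%g ->
      `|df0| > num / (Ssum abar 1%g - Ssum abar pi)) ->
   forall d (T : measurableType d) (P : probability T R) (N : T -> R -> nat),
   is_nhpp P (fun t => lbar * f t) N ->
   exists2 eps0 : R, 0 < eps0 &
     forall eps, 0 < eps -> eps < eps0 ->
     forall pi : 'S_n, pi != 1%g ->
       (exp_makespan P N 0 (sched abar eps 1%g)
          < exp_makespan P N 0 (sched abar eps pi))%E)
  /\
  (* (ii) LPT *)
  ((forall x y, 0 <= x -> x < y -> y <= eps1 * Abarn -> f x < f y) ->
   (forall pi : 'S_n, pi != revperm n ->
      df0 > num / (Ssum abar pi
          - \sum_(i < n) abar (rev_ord i)
              * (\sum_(k < n | (rev_ord i <= k)%N) abar k) ^+ 2)) ->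
   forall d (T : measurableType d) (P : probability T R) (N : T -> R -> nat),
   is_nhpp P (fun t => lbar * f t) N ->
   exists2 eps0 : R, 0 < eps0 &
     forall eps, 0 < eps -> eps < eps0 ->
     forall pi : 'S_n, pi != revperm n ->
       (exp_makespan P N 0 (sched abar eps (revperm n))
          < exp_makespan P N 0 (sched abar eps pi))%E).
Proof.
move=> abar0 abar_lt eps10 lbar0 f0 _ df _ fub fplus Abarn num.
have fle x : 0 <= x -> f x <= fplus.
  by move=> x0; apply: ub_le_sup => //; exists x.
have num0 : 0 <= num.
  have sq : 0 <= fplus ^+ 2 by exact: sqr_ge0.
  have A0 : 0 <= Abarn by apply: sumr_ge0 => i _; exact: ltW.
  have ss : 0 <= \sum_(i < n) abar i ^+ 2 by apply: sumr_ge0 => i _; exact: sqr_ge0.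
  rewrite /num mulr_ge0//; first by rewrite mulr_ge0// ltW.
  apply: addr_ge0; first by apply: mulr_ge0 => //; exact: mulr_ge0.
  by apply: mulr_ge0; [apply: mulr_ge0|exact: exprn_ge0].
have df' := right_derivative_bound df.
have lamE dl : 0 < dl -> exists2 u0 : R, 0 < u0 & forall u, 0 < u -> u <= u0 ->
    `|lbar * f u - lbar * f 0 - lbar * df0 * u| <= dl * u.
  move=> dl0; have [|u0 u00 H] := df' (dl / lbar); first by rewrite divr_gt0.
  exists u0 => // u u1 u2; rewrite -mulrA -!mulrBr normrM (gtr0_norm lbar0).
  apply: (@le_trans _ _ (lbar * (dl / lbar * u))); first by rewrite ler_pM2l// H.
  by rewrite le_eqVlt; apply/orP; left; apply/eqP; field; exact: lt0r_neq0.
have lam0 x : 0 < x -> 0 <= lbar * f x.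
  by move=> x0; rewrite mulr_ge0 ?(ltW lbar0)// ltW// f0// ltW.
have lamB x : 0 < x -> lbar * f x <= lbar * fplus.
  by move=> x0; rewrite ler_pM2l// fle// ltW.
have a0 : 0 < lbar * f 0 by rewrite mulr_gt0// f0.
have A_gt0 (pi sigma : 'S_n) : pi != sigma -> 0 < Abarn.
  move=> ne; have [i _] : exists i, pi i != sigma i.
    apply: contrapT => H; move/eqP: ne; apply; apply/permP => i.
    by apply/eqP; apply: contrapT => /negP ni; apply: H; exists i.
  by rewrite /Abarn (bigD1 i)//= ltr_wpDr// sumr_ge0// => j _; exact: ltW.
split=> [fdec slope|finc slope] dd T P N NP.
  (* Without a competing permutation any threshold will do; with one, the batch is nonempty and
     [A_gt0] applies. *)
  have [[pi0 pi01]|none] := pselect (exists pi : 'S_n, pi != 1%g); last first.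
    by exists 1 => // eps _ _ pi pi1; case: none; exists pi.
  (* The quotient in [slope] is nonnegative, so [df0] is nonzero; if it were positive, [f] would
     exceed [f 0] just after 0, against [fdec]. *)
  have df_lt0 : df0 < 0.
    have dfn0 : 0 < `|df0|.
      apply: le_lt_trans (slope pi0 pi01); rewrite divr_ge0// subr_ge0 ltW//.
      exact: Ssum_lt_id.
    rewrite lt_neqAle -normr_gt0 dfn0 /= leNgt; apply/negP => df_gt0.
    have [|u0 u00 H] := df' (df0 / 2); first by rewrite divr_gt0.
    (* Small enough for the linear bound with precision [df0 / 2], and inside the interval where [f]
       decreases. *)
    pose u := Num.min u0 (eps1 * Abarn).
    have u_gt0 : 0 < u by rewrite lt_min u00 mulr_gt0// (A_gt0 _ _ pi01).
    have := H u u_gt0; rewrite ge_min lexx => /(_ isT); rewrite ler_norml => /andP[lo _].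
    have fu : f u < f 0 by apply: fdec => //; rewrite ge_min lexx orbT.
    have : 0 < df0 * u by rewrite mulr_gt0.
    by move: lo fu; lra.
  apply: (eventually_optimal abar0 NP a0 lam0 lamB lamE) (A_gt0 _ _ pi01) => pi pi1.
  have : Ssum abar pi < Ssum abar 1%g by exact: Ssum_lt_id.
  by move=> lt; rewrite nmulr_rgt0 ?subr_lt0// pmulr_rlt0.
have [[pi0 pi01]|none] := pselect (exists pi : 'S_n, pi != revperm n); last first.
  by exists 1 => // eps _ _ pi pi1; case: none; exists pi.
have df_gt0 : 0 < df0.
  apply: le_lt_trans (slope pi0 pi01); rewrite Ssum_revE divr_ge0// subr_ge0 ltW//.
  exact: Ssum_lt_rev.
apply: (eventually_optimal abar0 NP a0 lam0 lamB lamE) (A_gt0 _ _ pi01) => pi pi1.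
by rewrite !mulr_gt0// subr_gt0; exact: Ssum_lt_rev.
Qed.
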